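(* Let $K$ be a compact Hausdorff space, let $X$ be a Banach space and let $T\colon C(K)\to X$ be an operator. Then the following assertions are equivalent: (i) $T$ is weakly compact; (ii) for each infinite $\prec$-chain $F\subseteq C(K)$, $$\inf\{\|Tf-Tg\|\colon f,g\in F,\ f\neq g\}=0.$$ In particular, every weakly compact operator $T\colon C(K)\to X$ satisfies condition (B).
   Context: Banach spaces are over either the real or the complex scalars. An operator is a bounded linear operator acting between Banach spaces. $C(K)$ is the Banach space of all scalar-valued continuous functions on $K$ with the supremum norm. The support $\mathrm{supp}(f)$ of $f\in C(K)$ is the closure of $\{x\in K\colon f(x)\neq 0\}$. For $f,g\in C(K)$ write $f\prec g$ if $f\neq g$ and $f(x)=g(x)$ for every $x\in\mathrm{supp}(f)$; this relation is a strict (partial) ordering on $C(K)$. A $\prec$-chain is a subset of $C(K)$ any two distinct elements of which are comparable under $\prec$. Condition (B) for an operator $T\colon C(K)\to X$: for each uncountable $\prec$-chain $F$ in $C(K)$ with $\sup_{f\in F}\|f\|<\infty$ one has $\inf\{\|Tf-Tg\|\colon f,g\in F,\ f\neq g\}=0$.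
   Formalization: In (ii) the infinite ≺-chains F are required to be norm bounded, sup‖f‖<∞, as in condition (B); without this bound (i)⇒(ii) fails, e.g. for Tf=Σ2^{-k}f(k) on the one-point compactification of {1,2,…} with f_n=Σ_{k≤n}2^k 1_{k}. *)

(* Defs.v *)
From HB Require Import structures.
From mathcomp Require Import all_boot all_order all_algebra.
From mathcomp Require Import all_classical all_reals all_analysis.
From mathcomp Require Import complex.

Set Implicit Arguments.
Unset Strict Implicit.
Unset Printing Implicit Defensive.

Import Order.TTheory GRing.Theory Num.Theory.
Import numFieldNormedType.Exports.

Local Open Scope classical_set_scope.
Local Open Scope ring_scope.

Variant scalar_kind := RealScalars | ComplexScalars.

Definition scalar_field (R : realType) (s : scalar_kind) : numFieldType :=
  match s with
  | RealScalars => R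
  | ComplexScalars => R[i]%C
  end.

(* Norms of normed modules over [F : numFieldType] take their values in [F]
   itself, so suprema and infima of norms are taken with respect to the partial
   order of [F]; on the real elements of R[i] it is the usual order of R. *)
Lemma norm_supremums (R : realType) (s : scalar_kind) (T : Type)
    (h : T -> scalar_field R s) :
  [set: T] !=set0 -> (exists M, forall x, `|h x| <= M) ->
  supremums [set `|h x| | x in [set: T]] !=set0.
Proof.
move=> [x0 _]; case: s h => /= h [M hM].
  exists (sup [set `|h x| | x in [set: T]]); split => [_ [x _ <-]|z zub].
    by apply: ub_le_sup; [exists M => _ [y _ <-]|exists x].
  apply: ge_sup; first by exists `|h x0|; exists x0.
  by move=> _ [x _ <-]; apply: zub; exists x.
pose n x : R := complex.Re `|h x|.
have nE x : `|h x| = ((n x)%:C)%C by rewrite /n normc_def.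
have nub z : (forall x, `|h x| <= z) ->
    complex.Im z = 0 /\ forall x, n x <= complex.Re z.
  move=> hz; have imz x : complex.Im z = 0 /\ n x <= complex.Re z.
    by move: (hz x); rewrite nE lecE /= => /andP[/eqP -> ->].
  by split=> [|x]; [exact: (imz x0).1|exact: (imz x).2].
exists ((sup [set n x | x in [set: T]])%:C)%C; split => [_ [x _ <-]|z zub].
  rewrite nE lecR; apply: ub_le_sup; last by exists x.
  by exists (complex.Re M) => _ [y _ <-]; exact: (nub _ hM).2.
have [imz rez] : complex.Im z = 0 /\ forall x, n x <= complex.Re z.
  by apply: nub => x; apply: zub; exists x.
rewrite lecE /= imz eqxx /=.
by apply: ge_sup => [|_ [x _ <-]//]; exists (n x0); exists x0.
Qed.

Lemma continuous_compact_bounded (F : numFieldType) (K : topologicalType)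
    (h : K -> F) :
  compact [set: K] -> continuous h -> exists M, forall x, `|h x| <= M.
Proof.
move=> /compact_near_coveringP cK hc.
have bh : \forall M \near +oo, [set: K] `<=` (fun x => `|h x| <= M).
  apply: cK => x _.
  exists ([set y | `|h x - h y| < 1], [set M | `|h x| + 1 <= M]) => /=.
    split; last by apply: nbhs_pinfty_ge; rewrite realD.
    by have /cvgrPdist_lt/(_ 1 ltr01) := hc x.
  move=> [y M] /= [hxy]; apply: le_trans.
  by rewrite -[h y](subKr (h x)) (le_trans (ler_normB _ _))// lerD2l ltW.
have /pinfty_ex_gt0[M _ hM] := bh.
by exists M => x; exact: hM.
Qed.

(* The compactness proof is part of the type: it is what makes the supremum
   norm below a norm. *)
Definition C_space (R : realType) (s : scalar_kind) (K : topologicalType)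
    (cK : compact [set: K]) : Type :=
  continuousType K (scalar_field R s).

Section C_space_normedModType.
Context (R : realType) (s : scalar_kind) (K : topologicalType).
Variable cK : compact [set: K].
Local Notation F := (scalar_field R s).
Local Notation CK := (C_space R s cK).

HB.instance Definition _ := Choice.on CK.

Let addC_cts (f g : CK) : continuous (fun x => f x + g x : F).
Proof. by move=> x; apply: cvgD; exact: cts_fun. Qed.
Let oppC_cts (f : CK) : continuous (fun x => - f x : F).
Proof. by move=> x; apply: cvgN; exact: cts_fun. Qed.
Let scaleC_cts (a : F) (f : CK) : continuous (fun x => a * f x : F).
Proof. by move=> x; apply: cvgM; [exact: cvg_cst|exact: cts_fun]. Qed.

Definition zeroC : CK := cst 0 : continuousType K F.
Definition addC (f g : CK) : CK := mkcts (@addC_cts f g).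
Definition oppC (f : CK) : CK := mkcts (@oppC_cts f).
Definition scaleC (a : F) (f : CK) : CK := mkcts (@scaleC_cts a f).

Let addCA : associative addC.
Proof. by move=> f g h; apply/continuousEP => x /=; exact: addrA. Qed.
Let addCC : commutative addC.
Proof. by move=> f g; apply/continuousEP => x /=; exact: addrC. Qed.
Let add0C : left_id zeroC addC.
Proof. by move=> f; apply/continuousEP => x /=; exact: add0r. Qed.
Let addNC : left_inverse zeroC oppC addC.
Proof. by move=> f; apply/continuousEP => x /=; exact: addNr. Qed.

HB.instance Definition _ := GRing.isZmodule.Build CK addCA addCC add0C addNC.

Let scaleCA (a b : F) (f : CK) : scaleC a (scaleC b f) = scaleC (a * b) f.
Proof. by apply/continuousEP => x /=; exact: mulrA. Qed.
Let scale1C : left_id 1 scaleC.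
Proof. by move=> f; apply/continuousEP => x /=; exact: mul1r. Qed.
Let scaleCDr : right_distributive scaleC +%R.
Proof. by move=> a f g; apply/continuousEP => x /=; exact: mulrDr. Qed.
Let scaleCDl (f : CK) : {morph scaleC^~ f : a b / a + b}.
Proof. by move=> a b; apply/continuousEP => x /=; exact: mulrDl. Qed.

HB.instance Definition _ :=
  GRing.Zmodule_isLmodule.Build F CK scaleCA scale1C scaleCDr scaleCDl.

(* The default value 0 is the norm of the only element of C(K) when K is
   empty. *)
Definition supnorm (f : CK) : F :=
  supremum 0 [set `|f x| | x in [set: K]].

Lemma supnorm_supremums (f : CK) (x : K) :
  supremums [set `|f y| | y in [set: K]] (supnorm f).
Proof.
rewrite /supnorm /supremum ifN; last by apply/set0P; exists `|f x|; exists x.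
have /set0P[M SM] : supremums [set `|f y| | y in [set: K]] != set0.
  apply/set0P/norm_supremums; first by exists x.
  by apply: continuous_compact_bounded => //; exact: cts_fun.
exact: (xgetPex 0 (ex_intro _ M SM)).
Qed.

Lemma supnorm_ub (f : CK) (x : K) : `|f x| <= supnorm f.
Proof. by apply: (supnorm_supremums f x).1; exists x. Qed.

Lemma supnorm_le (f : CK) (M : F) :
  0 <= M -> (forall x, `|f x| <= M) -> supnorm f <= M.
Proof.
move=> M0 fM; have [[x _]|K0] := pselect ([set: K] !=set0).
  by apply: (supnorm_supremums f x).2 => _ [y _ <-].
rewrite /supnorm (_ : image _ _ = set0) ?supremum0//.
by rewrite -subset0 => t [x _ _]; case: K0; exists x.
Qed.

Let supnorm_ge0 (f : CK) : 0 <= supnorm f.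
Proof.
have [[x _]|K0] := pselect ([set: K] !=set0).
  exact: (le_trans _ (supnorm_ub f x)).
rewrite /supnorm (_ : image _ _ = set0) ?supremum0//.
by rewrite -subset0 => t [x _ _]; case: K0; exists x.
Qed.

Let supnormD (f g : CK) : supnorm (f + g) <= supnorm f + supnorm g.
Proof.
apply: supnorm_le => [|x]; first by rewrite addr_ge0 ?supnorm_ge0.
by apply: (le_trans (ler_normD (f x) (g x))); rewrite lerD ?supnorm_ub.
Qed.

Let supnormZ (a : F) (f : CK) : supnorm (a *: f) = `|a| * supnorm f.
Proof.
apply/eqP; rewrite eq_le; apply/andP; split.
  apply: supnorm_le => [|x]; first by rewrite mulr_ge0 ?supnorm_ge0.
  by rewrite [X in X <= _](normrM a (f x)) ler_wpM2l ?supnorm_ub.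
have [->|a0] := eqVneq a 0; first by rewrite normr0 mul0r supnorm_ge0.
rewrite mulrC -ler_pdivlMr ?normr_gt0//; apply: supnorm_le => [|x].
  by rewrite divr_ge0 ?supnorm_ge0.
rewrite ler_pdivlMr ?normr_gt0// mulrC -normrM.
exact: (supnorm_ub (a *: f) x).
Qed.

Let supnorm0_eq0 (f : CK) : supnorm f = 0 -> f = 0.
Proof.
move=> f0; apply/continuousEP => x; apply/eqP; rewrite -normr_le0 -f0.
exact: supnorm_ub.
Qed.

HB.instance Definition _ :=
  @Lmodule_isNormed.Build F CK supnorm supnormD supnormZ supnorm0_eq0.

End C_space_normedModType.

Section weakly_compact.
Context (F : numFieldType) (V W : normedModType F).

Definition bounded_operator (T : {linear V -> W}) : Prop :=
  exists M : F, forall v, `|T v| <= M * `|v|.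

Definition weak_topology : Type :=
  @sup_topology W {phi : {linear W -> F^o} | continuous phi}
    (fun phi => Topological.class (initial_topology (projT1 phi))).

HB.instance Definition _ := Topological.on weak_topology.

Definition weakly_compact (T : {linear V -> W}) : Prop :=
  precompact (T @` [set v | `|v| <= 1] : set weak_topology).

End weakly_compact.

Section chain_conditions.
Context (R : realType) (s : scalar_kind) (K : topologicalType).
Context (cK : compact [set: K]).
Local Notation F := (scalar_field R s).
Local Notation CK := (C_space R s cK).

Definition supp (f : CK) : set K := closure [set x | f x != 0].

Definition prec (f g : CK) : Prop :=
  f <> g /\ forall x, supp f x -> f x = g x.

Definition prec_chain (A : set CK) : Prop :=
  forall f g, A f -> A g -> f <> g -> prec f g \/ prec g f.

Context (X : normedModType F) (T : {linear CK -> X}).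

Definition inf_dist_eq0 (A : set CK) : Prop :=
  infimums [set d | exists f g, [/\ A f, A g, f <> g & d = `|T f - T g|]] 0.

(* The chains are norm bounded, as in condition (B). Over all infinite chains
   the equivalence with weak compactness fails: for K the one-point
   compactification of the discrete space {1, 2, ...}, the bounded functional
   T f = \sum_k 2^-k f(k) is weakly compact, but the functions
   f_n = \sum_(k <= n) 2^k 1_{k} form a chain with T f_n = n. *)
Definition infinite_chain_condition : Prop :=
  forall A : set CK, infinite_set A -> prec_chain A -> bounded_set A ->
    inf_dist_eq0 A.

Definition condition_B : Prop :=
  forall A : set CK, ~ countable A -> prec_chain A -> bounded_set A ->
    inf_dist_eq0 A.

End chain_conditions.

(* Main.v *)
Require Import Defs.
From HB Require Import structures.
From mathcomp Require Import all_boot all_order all_algebra.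
From mathcomp Require Import all_classical all_reals all_analysis.
From mathcomp Require Import complex.
From mathcomp Require Import ring lra.

Set Implicit Arguments.
Unset Strict Implicit.
Unset Printing Implicit Defensive.

Import Order.TTheory GRing.Theory Num.Theory.
Import numFieldNormedType.Exports.

Local Open Scope classical_set_scope.
Local Open Scope ring_scope.

(** Weak compactness and the chain condition are both compared with a third
    condition on T, called [disjointly_small] below: every sequence of pairwise
    disjoint functions in the unit ball of C(K) has terms with images of
    arbitrarily small norm.

    Suppose that it fails. Norming functionals and Rosenthal's lemma give
    disjoint f_n in the unit ball and functionals psi_n of norm at most 1 with
    psi_n (T f_n) >= e and with the sum of the |psi_n (T f_k)| over k <> n at
    most e / 4 ([not_disjointly_small]). The partial sums g_m of the f_n form a
    chain in the unit ball, and psi_n shows that T g_n and T g_m are e / 2 apart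
    if n < m, so the chain condition fails ([almost_biorthogonal_chain]). Weak
    compactness fails too ([almost_biorthogonal_weakly_compact]): if the T g_m
    had a weak cluster point x, every psi_n would be at least 3e / 4 at x, hence
    so would a pointwise cluster point psi of the psi_n; but psi is at most
    e / 4 at every T g_m.

    Suppose that it holds. An exhaustion argument makes it uniform: for every e
    there is a bound on the number of disjoint functions in the unit ball with
    images of norm greater than e ([disjointly_small_uniform]). The chain
    condition follows because consecutive differences along a chain are
    disjoint ([uniformly_disjointly_small_chain]).

    For weak compactness, the uniform condition provides for every e a positive
    measure mu on K and a constant N such that |T f| is at most
    N mu(|f|^2) + e for f in the unit ball ([quadratic_estimate]). Otherwise
    there would be functions f_k in the unit ball and functionals psi_k with
    psi_k (T f_k) > e such that |f_k|^2 has a tiny integral against the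
    variation of psi_i T for all i < k; removing from each f_i the places where
    some later f_k is not small would leave a large disjoint family. A
    combination of these measures serves all e at once
    ([quadratic_domination]). Now let an ultrafilter contain the unit ball. In
    the convex hulls of its members, the functions whose L^2(mu) norm is nearly
    minimal are close to each other by the parallelogram law, as in the
    projection theorem for Hilbert spaces. So their images converge in norm
    ([midhull_limit]), and the limit is the weak limit of the images along the
    ultrafilter because half-spaces are convex. *)

(** * Norms as real numbers *)

Section scalars.
Context (R : realType) (s : scalar_kind).
Local Notation F := (scalar_field R s).

Definition emb : R -> F :=
  match s return R -> scalar_field R s with
  | RealScalars => id
  | ComplexScalars => fun a => (a%:C)%C
  end.

Definition rpart : F -> R :=
  match s return scalar_field R s -> R with
  | RealScalars => id
  | ComplexScalars => @complex.Re R
  end.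

Lemma emb_is_additive : additive emb.
Proof. by rewrite /emb; case: s => // a b; rewrite rmorphB. Qed.

Lemma emb_is_multiplicative : multiplicative emb.
Proof. by rewrite /emb; case: s => //; split=> // a b; rewrite rmorphM. Qed.

HB.instance Definition _ := GRing.isAdditive.Build R F emb emb_is_additive.
HB.instance Definition _ :=
  GRing.isMultiplicative.Build R F emb emb_is_multiplicative.

Lemma rpart_is_additive : additive rpart.
Proof. by rewrite /rpart; case: s => // -[a b] [c d]. Qed.

HB.instance Definition _ := GRing.isAdditive.Build F R rpart rpart_is_additive.

Lemma embK : cancel emb rpart.
Proof. by rewrite /emb /rpart; case: s. Qed.

Lemma rpart_embM a z : rpart (emb a * z) = a * rpart z.
Proof.
rewrite /emb /rpart; by case: s z => [z|[x y]] //=; rewrite mul0r subr0.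
Qed.

Lemma rpartK z : 0 <= z -> emb (rpart z) = z.
Proof.
rewrite /emb /rpart; case: s z => [z|[x y]] //=.
by rewrite lecE /= => /andP[/eqP -> _].
Qed.

Lemma ler_emb a b : (emb a <= emb b) = (a <= b).
Proof. by rewrite /emb; case: s => //; rewrite lecR. Qed.

Lemma ltr_emb a b : (emb a < emb b) = (a < b).
Proof. by rewrite /emb; case: s => //; rewrite ltcR. Qed.

Lemma ler_rpart y z : y <= z -> rpart y <= rpart z.
Proof.
rewrite /rpart; case: s y z => // -[a b] [c d] /=.
by rewrite lecE /= => /andP[].
Qed.

Lemma rpart_le_norm z : `|rpart z| <= rpart `|z|.
Proof.
rewrite /rpart; case: s z => // -[a b] /=.
rewrite -sqrtr_sqr; by apply: ler_wsqrtr; rewrite lerDl sqr_ge0.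
Qed.

(** The norm takes values in the scalar field, which is only partially ordered
    in the complex case; all estimates are made with this real-valued form. *)
Definition rn (V : normedModType F) (x : V) : R := rpart `|x|.

(** A scalar of norm at least e has real part at least e / 2 after one of these
    rotations. *)
Definition turns : seq F :=
  match s return seq (scalar_field R s) with
  | RealScalars => [:: 1; -1]
  | ComplexScalars => [:: 1; -1; 'i%C; - 'i%C]
  end.

End scalars.
Arguments emb {R s}.
Arguments rpart {R s}.

Section real_norm.
Context (R : realType) (s : scalar_kind).
Local Notation F := (scalar_field R s).
Implicit Types (V : normedModType F) (a : R).

Lemma rnE V (x : V) : emb (rn x) = `|x|.
Proof. exact: rpartK. Qed.

Lemma rn_ge0 V (x : V) : 0 <= rn x.
Proof. by rewrite -(ler_emb s) rnE rmorph0. Qed.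

Lemma rnD V (x y : V) : rn (x + y) <= rn x + rn y.
Proof. by rewrite -(ler_emb s) rmorphD /= !rnE ler_normD. Qed.

Lemma rnN V (x : V) : rn (- x) = rn x.
Proof. by rewrite /rn normrN. Qed.

Lemma rn_dist V (x y : V) : rn (x - y) = rn (y - x).
Proof. by rewrite -rnN opprB. Qed.

Lemma rnB V (x y : V) : rn x - rn y <= rn (x - y).
Proof. by rewrite lerBlDr; apply: le_trans (rnD _ _); rewrite subrK. Qed.

Lemma rn0 V : rn (0 : V) = 0.
Proof. by rewrite /rn normr0 raddf0. Qed.

Lemma rn_eq0 V (x : V) : rn x = 0 -> x = 0.
Proof. by move=> x0; apply/eqP; rewrite -normr_eq0 -rnE x0 rmorph0. Qed.

Lemma norm_emb a : `|emb a : F| = emb `|a|.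
Proof.
case: (leP 0 a) => a0.
  by rewrite !ger0_norm// -(rmorph0 (@emb R s)) ler_emb.
rewrite (ltr0_norm a0) ltr0_norm ?rmorphN//.
by rewrite -(rmorph0 (@emb R s)) ltr_emb.
Qed.

Lemma rnZ V a (x : V) : rn (emb a *: x) = `|a| * rn x.
Proof. by rewrite /rn normrZ norm_emb rpart_embM. Qed.

Lemma rn_emb a : rn (emb a : F) = `|a|.
Proof. by rewrite /rn norm_emb embK. Qed.

Lemma rn_scale V (c : F) (x : V) : rn (c *: x) = rn c * rn x.
Proof. by rewrite {1}/rn normrZ -(rnE c) rpart_embM. Qed.

Lemma rnM (c d : F) : rn (c * d) = rn c * rn d.
Proof. exact: (rn_scale (V := F) c d). Qed.

Lemma rn_sum V (I : Type) (r : seq I) (f : I -> V) :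
  rn (\sum_(i <- r) f i) <= \sum_(i <- r) rn (f i).
Proof.
elim: r => [|i r IH]; first by rewrite !big_nil rn0.
by rewrite !big_cons (le_trans (rnD _ _)) ?lerD2l.
Qed.

Lemma rn_parallelogram (c d : F) :
  rn (c + d) ^+ 2 + rn (c - d) ^+ 2 = 2 * (rn c ^+ 2 + rn d ^+ 2).
Proof.
rewrite /rn /rpart; case: s c d => /= [c d|[a b] [c d]] /=.
  by rewrite !real_normK ?num_real//; ring.
by rewrite !sqr_sqrtr ?addr_ge0 ?sqr_ge0//; ring.
Qed.

Lemma rpart_le_rn (z : F) : rpart z <= rn z.
Proof. exact: le_trans (ler_norm _) (rpart_le_norm _). Qed.

Lemma rn_lt_turns (z : F) (e : R) :
  (forall c, c \in turns R s -> rpart (c * z) < e / 2) -> rn z < e.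
Proof.
rewrite /rn /turns /rpart; case: s z => /= [z|[a b]] H.
  have := H 1; have := H (-1); rewrite !inE !eqxx !orbT /= mul1r mulN1r.
  move=> /(_ isT) h1 /(_ isT) h2; rewrite ltr_norml.
  by apply/andP; split; lra.
have : forall c, c \in [:: 1; -1; 'i%C; - 'i%C] ->
  complex.Re (c * (a +i* b)%C) < e / 2 by [].
move=> {}H.
have := H 1; have := H (-1); have := H 'i%C; have := H (- 'i%C).
rewrite !inE !eqxx !orbT /= => /(_ isT) h1 /(_ isT) h2 /(_ isT) h3 /(_ isT) h4.
move: h1 h2 h3 h4; rewrite /= => h1 h2 h3 h4.
have e0 : 0 < e by lra.
rewrite -(ltr_pXn2r (n := 2)) ?nnegrE ?sqrtr_ge0 ?ltW//.
rewrite sqr_sqrtr ?addr_ge0 ?sqr_ge0//.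
have sqr_lt (u : R) : - (e / 2) < u -> u < e / 2 -> u ^+ 2 < (e / 2) ^+ 2.
  move=> u1 u2; rewrite -real_normK ?num_real//.
  by rewrite ltr_pXn2r ?nnegrE ?normr_ge0 ?ltr_norml ?u1//; lra.
have : a ^+ 2 < (e / 2) ^+ 2 by apply: sqr_lt; lra.
have : b ^+ 2 < (e / 2) ^+ 2 by apply: sqr_lt; lra.
have : 0 < e ^+ 2 by rewrite exprn_gt0.
rewrite expr_div_n; lra.
Qed.

Lemma rn_turns (c : F) : c \in turns R s -> rn c = 1.
Proof.
rewrite /rn /turns /rpart; case: s c => /= c.
  by rewrite !inE => /orP[]/eqP ->; rewrite ?normrN normr1.
by rewrite !inE => /or4P[]/eqP -> /=;
  rewrite ?oppr0 ?expr0n /= ?sqrrN ?expr1n ?addr0 ?add0r sqrtr1.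
Qed.

Lemma nbhs_rnP V (x : V) (A : set V) :
  nbhs x A <-> exists2 e : R, 0 < e & forall y, rn (x - y) < e -> A y.
Proof.
split=> [/nbhs_normP[e /= e0 eA]|[e e0 eA]].
  exists (rpart e) => [|y xy].
    by rewrite -(ltr_emb s) rmorph0 rpartK ?ltW.
  by apply: eA => /=; rewrite -rnE -[ltRHS]rpartK ?ltW// ltr_emb.
apply/nbhs_normP; exists (emb e) => /= [|y /=].
  by rewrite -(rmorph0 (@emb R s)) ltr_emb.
by rewrite -rnE ltr_emb; exact: eA.
Qed.

Lemma cvg_rnP (K : Type) (G : set_system K) (FG : Filter G) V (f : K -> V) l :
  f @ G --> l <-> forall e : R, 0 < e -> \forall y \near G, rn (l - f y) < e.
Proof.
split=> [fl e e0|H A /nbhs_rnP[e e0 eA]].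
  by apply: (fl [set z | rn (l - z) < e]); apply/nbhs_rnP; exists e.
by apply: filterS (H e e0) => y; exact: eA.
Qed.

Lemma emb_continuous : continuous (@emb R s).
Proof.
move=> a; apply/cvg_rnP => e e0; near=> b.
rewrite -rmorphB /= rn_emb; near: b.
exact: cvgr_dist_lt.
Unshelve. all: by end_near. Qed.

Lemma rpart_continuous : continuous (@rpart R s).
Proof.
move=> z; apply/(@cvgrPdist_lt _ _ _ _ (nbhs_filter z)) => e e0.
apply: (proj2 (nbhs_rnP z _)).
exists e => // y.
by rewrite -raddfB; apply: le_lt_trans; exact: rpart_le_norm.
Qed.

Lemma rn_continuous V : continuous (@rn R s V).
Proof.
move=> x; apply/(@cvgrPdist_lt _ _ _ _ (nbhs_filter x)) => e e0.
apply: (proj2 (nbhs_rnP x _)).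
exists e => // y.
apply: le_lt_trans; rewrite ler_norml; apply/andP; split.
  by have := rnB y x; rewrite rn_dist; lra.
exact: rnB.
Qed.

End real_norm.

(** * The Hahn-Banach theorem *)

Section hahn_banach.
Context (R : realType) (V : lmodType R).
Implicit Types (p q : V -> R) (x y : V).

(** Equality in the second clause follows, see [sublinearZ]. *)
Definition sublinear p :=
  (forall x y, p (x + y) <= p x + p y) /\
  (forall a x, 0 <= a -> p (a *: x) <= a * p x).

Lemma sublinear0 p : sublinear p -> p 0 = 0.
Proof.
move=> [pD pZ]; have := pZ 0 0 (lexx _); rewrite scale0r mul0r.
have := pD 0 0; rewrite addr0 => p0 p0'; apply/eqP.
by rewrite eq_le; apply/andP; split; lra.
Qed.

Lemma sublinearZ p a x : sublinear p -> 0 <= a -> p (a *: x) = a * p x.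
Proof.
move=> sp; rewrite le_eqVlt => /predU1P[<-|a0].
  by rewrite scale0r mul0r sublinear0.
apply/eqP; rewrite eq_le (sp.2 _ _ (ltW a0)) /=.
have := sp.2 a^-1 (a *: x).
rewrite invr_ge0 (ltW a0) scalerA mulVf ?gt_eqF// scale1r ler_pdivlMl//.
by move=> /(_ isT).
Qed.

Lemma sublinearN p x : sublinear p -> - p (- x) <= p x.
Proof. by move=> sp; have := sp.1 x (- x); rewrite subrr sublinear0//; lra. Qed.

Let descent p y x := inf [set p (x + t *: y) - t * p y | t in [set t | 0 <= t]].

Let descent_lb p y x t : sublinear p -> 0 <= t ->
  - p (- x) <= p (x + t *: y) - t * p y.
Proof.
move=> sp t0; rewrite -sublinearZ//.
by have := sp.1 (x + t *: y) (- x); rewrite addrC addKr; lra.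
Qed.

Let descent_le p y x t : sublinear p -> 0 <= t ->
  descent p y x <= p (x + t *: y) - t * p y.
Proof.
move=> sp t0; apply: ge_inf; last by exists t.
by exists (- p (- x)) => _ [u u0 <-]; exact: descent_lb.
Qed.

Let le_descent p y x b :
  (forall t, 0 <= t -> b <= p (x + t *: y) - t * p y) -> b <= descent p y x.
Proof.
move=> H; apply: lb_le_inf => [|_ [t t0 <-]]; last exact: H.
by exists (p (x + 0 *: y) - 0 * p y); exists 0 => /=.
Qed.

Let descent_lep p y x : sublinear p -> descent p y x <= p x.
Proof.
move=> sp; have := @descent_le p y x 0 sp (lexx _).
by rewrite scale0r mul0r addr0 subr0.
Qed.

(** The infimum of p (x + t y) - t p y over t >= 0 is sublinear again. Values
    t > 0 make it smaller than p at - y, unless p (- y) = - p y already. *)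
Lemma sublinear_descent p y : sublinear p -> exists q, [/\ sublinear q,
  forall x, q x <= p x & q (- y) <= - p y].
Proof.
move=> sp; exists (descent p y); split; last 2 first.
- by move=> x; exact: descent_lep.
- have := @descent_le p y (- y) 1 sp ler01.
  by rewrite scale1r addNr sublinear0// mul1r sub0r.
split=> [x z|a x].
  rewrite -lerBlDr; apply: le_descent => t t0.
  rewrite lerBlDl -lerBlDr; apply: le_descent => u u0.
  rewrite lerBlDl.
  apply: le_trans (descent_le _ _ _ (addr_ge0 t0 u0)) _ => //.
  have := sp.1 (x + t *: y) (z + u *: y).
  by rewrite addrACA -scalerDl mulrDl; lra.
rewrite le_eqVlt => /predU1P[<-|a0].
  by rewrite scale0r mul0r (le_trans (descent_lep _ _ _))// sublinear0.
rewrite -ler_pdivrMl//; apply: le_descent => t t0; rewrite ler_pdivrMl//.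
apply: le_trans (descent_le _ _ sp (mulr_ge0 (ltW a0) t0)) _.
by rewrite -scalerA -scalerDr (sublinearZ _ sp (ltW a0)); lra.
Qed.

(** Zorn's lemma: the pointwise infimum of a chain of sublinear functionals is
    sublinear, and below p it is bounded at x by - p (- x). *)
Lemma minimal_sublinear p : sublinear p -> exists q,
  [/\ sublinear q, forall x, q x <= p x &
   forall r, sublinear r -> (forall x, r x <= q x) -> r = q].
Proof.
move=> sp.
pose T := {q : V -> R | sublinear q /\ forall x, q x <= p x}.
pose below (q r : T) := `[< forall x, sval r x <= sval q x >].
have lbT (q : T) x : - p (- x) <= sval q x.
  case: q => q /= [sq qp]; apply: le_trans (sublinearN x sq).
  by rewrite lerN2 qp.
have [||||[m [sm mp]] mmin] := @Zorn T below.
- by move=> q; apply/asboolP.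
- move=> q r t /asboolP qr /asboolP rt; apply/asboolP => x.
  exact: le_trans (rt x) (qr x).
- move=> [q pq] [r pr] /asboolP /= qr /asboolP /= rq.
  have E : q = r by apply/funext => x; apply/eqP; rewrite eq_le qr rq.
  by subst r; congr exist; exact: Prop_irrelevance.
- move=> A Atot; have [[q0 Aq0]|A0] := pselect (A !=set0); last first.
    exists (exist _ p (conj sp (fun x => lexx _))) => q Aq.
    by case: A0; exists q.
  pose m x := inf [set sval q x | q in A].
  have m_le (q : T) x : A q -> m x <= sval q x.
    move=> Aq; apply: ge_inf; last by exists q.
    by exists (- p (- x)) => _ [r _ <-]; exact: lbT.
  have le_m b x : (forall q : T, A q -> b <= sval q x) -> b <= m x.
    move=> H; apply: lb_le_inf => [|_ [q Aq <-]]; last exact: H.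
    by exists (sval q0 x); exists q0.
  have mp x : m x <= p x.
    by apply: le_trans (m_le q0 x Aq0) _; exact: (svalP q0).2.
  have sm : sublinear m.
    split=> [x y|a x].
      rewrite -lerBlDr; apply: (le_m) => q Aq.
      rewrite lerBlDl -lerBlDr; apply: (le_m) => r Ar.
      rewrite lerBlDr.
      have [/asboolP qr|/asboolP rq] := Atot q r Aq Ar.
        apply: le_trans (m_le _ _ Ar) _.
        apply: le_trans ((svalP r).1.1 x y) _.
        by have := qr x; lra.
      apply: le_trans (m_le _ _ Aq) _.
      apply: le_trans ((svalP q).1.1 x y) _.
      by have := rq y; lra.
    rewrite le_eqVlt => /predU1P[<-|a0].
      rewrite scale0r mul0r; apply: le_trans (m_le _ _ Aq0) _.
      by rewrite (sublinear0 (svalP q0).1).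
    rewrite -ler_pdivrMl//; apply: (le_m) => q Aq; rewrite ler_pdivrMl//.
    apply: le_trans (m_le _ _ Aq) _.
    by rewrite (sublinearZ _ (svalP q).1 (ltW a0)).
  by exists (exist _ m (conj sm mp)) => q Aq; apply/asboolP => x; exact: m_le.
exists m; split=> // r sr rm.
have rp x : r x <= p x by exact: le_trans (rm x) (mp x).
have := mmin (exist _ r (conj sr rp)) _.
by move=> /(_ (introT (asboolP _) rm)) [].
Qed.

(** A minimal sublinear functional cannot be descended any further, so it is
    odd, and therefore linear. One descent at x0 before minimizing forces the
    value at x0. *)
Theorem hahn_banach p x0 : sublinear p -> exists f : V -> R,
  [/\ forall x y, f (x + y) = f x + f y, forall a x, f (a *: x) = a * f x,
      forall x, f x <= p x & f x0 = p x0].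
Proof.
move=> sp; have [p1 [sp1 p1p p1x0]] := sublinear_descent x0 sp.
have [f [sf fp1 fmin]] := minimal_sublinear sp1.
have fN x : f (- x) = - f x.
  have [q [sq qf qx]] := sublinear_descent x sf.
  have E := fmin q sq qf; subst q; apply/eqP; rewrite eq_le qx /=.
  by have := sublinearN x sf; lra.
have fD x y : f (x + y) = f x + f y.
  apply/eqP; rewrite eq_le sf.1 /=.
  by have := sf.1 (x + y) (- y); rewrite addrK fN; lra.
have fp x : f x <= p x by exact: le_trans (fp1 x) (p1p x).
exists f; split=> //.
  move=> a x; have [a0|/ltW a0] := leP 0 a; first exact: sublinearZ.
  rewrite -[LHS]opprK -fN -scaleNr sublinearZ// ?mulNr ?opprK//.
  by rewrite oppr_ge0.
apply/eqP; rewrite eq_le fp /=.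
by have := fp1 (- x0); rewrite fN; lra.
Qed.

End hahn_banach.

(** * Real parts of bounded functionals *)

(** An alias of the carrier, to which real scalars are attached. *)
Definition realify (R : realType) (s : scalar_kind)
  (V : lmodType (scalar_field R s)) : Type := V.

Section realify.
Context (R : realType) (s : scalar_kind) (V : lmodType (scalar_field R s)).
Local Notation VR := (realify V).

HB.instance Definition _ := GRing.Zmodule.on VR.

Let scale (a : R) (x : VR) : VR := emb a *: (x : V).
Let scaleA a b x : scale a (scale b x) = scale (a * b) x.
Proof. by rewrite /scale scalerA rmorphM. Qed.
Let scale1 : left_id 1 scale.
Proof. by move=> x; rewrite /scale rmorph1 scale1r. Qed.
Let scaleDr : right_distributive scale +%R.
Proof. by move=> a x y; rewrite /scale scalerDr. Qed.
Let scaleDl x : {morph scale^~ x : a b / a + b}.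
Proof. by move=> a b; rewrite /scale rmorphD scalerDl. Qed.

HB.instance Definition _ :=
  GRing.Zmodule_isLmodule.Build R VR scaleA scale1 scaleDr scaleDl.

End realify.

Section real_functionals.
Context (R : realType) (s : scalar_kind).
Local Notation F := (scalar_field R s).
Context (X : normedModType F).
Implicit Types f : X -> R.

(** The real parts of the functionals of norm at most one. *)
Definition dual_ball f := [/\ forall x y, f (x + y) = f x + f y,
  forall a x, f (emb a *: x) = a * f x & forall x, `|f x| <= rn x].

Lemma dual_ball0 f : dual_ball f -> f 0 = 0.
Proof. by move=> [fD _ _]; have := fD 0 0; rewrite addr0; lra. Qed.

Lemma dual_ballN f x : dual_ball f -> f (- x) = - f x.
Proof.
move=> cf; have [fD _ _] := cf.
by have := fD x (- x); rewrite subrr dual_ball0//; lra.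
Qed.

Lemma dual_ballB f x y : dual_ball f -> f (x - y) = f x - f y.
Proof. by move=> cf; have [fD _ _] := cf; rewrite fD dual_ballN. Qed.

Lemma dual_ball_sum f (I : Type) (r : seq I) (g : I -> X) : dual_ball f ->
  f (\sum_(i <- r) g i) = \sum_(i <- r) f (g i).
Proof.
move=> cf; have [fD _ _] := cf.
by elim: r => [|i r IH]; rewrite ?big_nil ?dual_ball0// !big_cons fD IH.
Qed.

Lemma norming_dual_ball (x : X) : exists2 f, dual_ball f & f x = rn x.
Proof.
have sp : @sublinear R (realify X) (@rn R s X).
  split=> [y z|a y a0]; first exact: rnD.
  by rewrite [X in X <= _]rnZ ger0_norm.
have [f [fD fZ fle fx]] := @hahn_banach R (realify X) _ x sp.
exists f => //; split=> // y; rewrite ler_norml fle andbT.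
have := fle (- y); have := fD y (- y); rewrite subrr.
have := fZ 0 0; rewrite scaler0 mul0r.
have -> : rn (- y : realify X) = rn (y : X) by exact: rnN.
lra.
Qed.

End real_functionals.

(** Every rotation of the value at x is the value at a rotation of x, so the
    bound on real parts bounds the modulus. *)
Lemma rpart_bounded_continuous (R : realType) (s : scalar_kind)
    (X : normedModType (scalar_field R s))
    (phi : {linear X -> (scalar_field R s)^o}) :
  (forall x, rpart (phi x) <= rn x) -> continuous phi.
Proof.
move=> phile x; apply: (proj2 (@cvg_rnP R s _ _ _ (scalar_field R s) _ _)).
move=> e e0; apply: (proj2 (@nbhs_rnP R s X x _)); exists (e / 2); first lra.
move=> y xy; have -> : phi x - phi y = phi (x - y) by rewrite linearB.
apply: rn_lt_turns => c ct; have -> : c * phi (x - y) = phi (c *: (x - y)).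
  by rewrite linearZ.
by apply: le_lt_trans (phile _) _; rewrite rn_scale (rn_turns ct) mul1r.
Qed.

(** Over the complex numbers the functional is x |-> f x - i f (i x). *)
Lemma dual_ball_rpart (R : realType) (s : scalar_kind)
    (X : normedModType (scalar_field R s)) (f : X -> R) : dual_ball f ->
  exists2 phi : {linear X -> (scalar_field R s)^o}, continuous phi &
    forall x, rpart (phi x) = f x.
Proof.
move=> cf; suff [phi phif] : exists phi : {linear X -> (scalar_field R s)^o},
    forall x, rpart (phi x) = f x.
  exists phi => //; apply: rpart_bounded_continuous => x.
  by rewrite phif; have [_ _ fle] := cf; exact: le_trans (ler_norm _) (fle x).
case: s X f cf => /= X f [fD fZ _].
  have lphi : linear (f : X -> R^o) by move=> a x y; rewrite fD fZ.
  pose L := GRing.isLinear.Build R X R^o _ (f : X -> R^o) lphi.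
  pose phi : {linear X -> R^o} := HB.pack (f : X -> R^o) L.
  by exists phi.
pose phi : X -> R[i]^o := fun x => (f x +i* (- f ('i%C *: x)))%C.
have fC (b : R[i]) z : f (b *: z) =
    complex.Re b * f z + complex.Im b * f ('i%C *: z).
  rewrite -!fZ -fD /=; congr (f _); rewrite scalerA -scalerDl; congr (_ *: _).
  case: b => u v; apply/eqP; rewrite eq_complex /=.
  by apply/andP; split; apply/eqP; ring.
have lphi : linear phi.
  move=> a x y; rewrite /phi !scalerDr !fD.
  rewrite scalerA fC (fC ('i%C * a)); case: a => a b /=.
  by apply/eqP; rewrite eq_complex /=; apply/andP; split; apply/eqP; ring.
pose L := GRing.isLinear.Build R[i] X R[i]^o _ phi lphi.
pose Phi : {linear X -> R[i]^o} := HB.pack phi L.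
by exists Phi.
Qed.

(** * Rosenthal's lemma *)

(** Split the indices into infinitely many infinite sets. If on each of them
    some row has a large off-diagonal sum, the matrix indexed by these rows has
    row sums smaller by delta, so this happens finitely often. *)
Lemma rosenthal (R : realType) (a : nat -> nat -> R) (C delta : R) :
  (forall n k, 0 <= a n k) ->
  (forall n (r : seq nat), uniq r -> \sum_(k <- r) a n k <= C) -> 0 < delta ->
  exists2 f : nat -> nat, injective f &
    forall n (r : seq nat), uniq r -> n \notin r ->
      \sum_(k <- r) a (f n) (f k) <= delta.
Proof.
move=> a0 aC d0.
have [m] : exists m, C <= delta *+ m.
  have C0 : 0 <= C by have := aC 0%N [::] isT; rewrite big_nil.
  exists (Num.bound (C / delta)).
  rewrite -mulr_natl -ler_pdivrMr// ltW// archi_boundP// divr_ge0// ltW//.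
elim: m C a a0 aC => [|m IH] C a a0 aC Cm.
  exists id => // n r ur _; apply: le_trans (aC n r ur) _.
  exact: le_trans Cm (ltW d0).
(* The j-th of infinitely many disjoint infinite sets of indices. *)
pose sigma j i := @pickle (nat * nat)%type (j, i).
have sigmaI j i j' i' : sigma j i = sigma j' i' -> j = j' /\ i = i'.
  by move=> /(pcan_inj pickleK)[-> ->].
have [[j good]|bad] := pselect (exists j, forall n r, uniq r -> n \notin r ->
    \sum_(k <- r) a (sigma j n) (sigma j k) <= delta).
  by exists (sigma j) => // i i' /sigmaI[].
have {bad} bad j : exists nr : nat * seq nat, [/\ uniq nr.2, nr.1 \notin nr.2 &
    delta < \sum_(k <- nr.2) a (sigma j nr.1) (sigma j k)].
  apply: contrapT => H; apply: bad; exists j => n r ur nr.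
  by rewrite leNgt; apply/negP => ?; apply: H; exists (n, r).
have {bad}[g gP] := choice bad.
pose tau j := sigma j (g j).1.
have tauI : injective tau by move=> j j' /sigmaI[].
have [|||f fI fP] := IH (C - delta) (fun j k => a (tau j) (tau k)).
- by move=> *; exact: a0.
- move=> j r ur; have [ug gN gd] := gP j.
  have := aC (tau j) (map tau r ++ map (sigma j) (g j).2).
  rewrite cat_uniq !map_inj_uniq//; last by move=> i i' /sigmaI[].
  rewrite ur ug /= andbT big_cat !big_map => /(_ _).
  have -> : ~~ has (in_mem^~ (mem (map tau r))) (map (sigma j) (g j).2).
    apply/hasPn => _ /mapP[i ig ->]; apply/mapP => -[k kr /sigmaI[jk ik]].
    by subst k; move: gN; rewrite -ik ig.
  by move=> /(_ isT) /=; lra.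
- by rewrite lerBlDr -mulrSr.
by exists (tau \o f) => //; exact: inj_comp.
Qed.

(** * Disjoint continuous functions *)

Section continuous_functions.
Context (R : realType) (s : scalar_kind) (K : topologicalType).
Context (cK : compact [set: K]).
Local Notation F := (scalar_field R s).
Local Notation CK := (C_space R s cK).
Implicit Types (f g h : CK) (k u : K -> R).

Lemma rn_point f x : rn (f x) <= rn f.
Proof. by rewrite /rn; apply: ler_rpart; exact: supnorm_ub. Qed.

Lemma rn_supP f M : 0 <= M -> (forall x, rn (f x) <= M) -> rn f <= M.
Proof.
move=> M0 fM; rewrite -(ler_emb s) rnE.
apply: (supnorm_le (f := f)) => [|x].
  by rewrite -(rmorph0 (@emb R s)) ler_emb.
by rewrite -rnE ler_emb.
Qed.

Lemma C_sumE (I : Type) (r : seq I) (f : I -> CK) x :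
  (\sum_(i <- r) f i) x = \sum_(i <- r) f i x.
Proof.
by elim: r => [|i r IH]; rewrite ?big_nil// !big_cons -IH.
Qed.

Let Cmul_cts k (ck : continuous k) f :
  continuous (fun x => emb (k x) * f x : F).
Proof.
move=> x; apply: (@cvgM _ _ (nbhs x)).
  apply: (@continuous_comp _ _ _ k (@emb R s)); first exact: ck.
  exact: emb_continuous.
exact: cts_fun.
Qed.

Definition Cmul k (ck : continuous k) f : CK := mkcts (@Cmul_cts k ck f).

Lemma rn_Cmul k (ck : continuous k) f x : rn (Cmul ck f x) = `|k x| * rn (f x).
Proof. by rewrite /= /mkcts rnM rn_emb. Qed.

Lemma rnC_continuous f : continuous (fun x => rn (f x)).
Proof.
move=> x; apply: (@continuous_comp _ _ _ f (@rn R s F)); first exact: cts_fun.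
exact: rn_continuous.
Qed.

Lemma C_neq0_nbhs (f : CK) x : f x != 0 -> \forall y \near x, f y != 0.
Proof.
move=> fx; have r0 : 0 < rn (f x).
  by rewrite lt_neqAle rn_ge0 andbT; apply: contra_neq fx => /esym/rn_eq0.
apply: (@cts_fun _ _ f x [set z | z != 0]).
apply: (proj2 (nbhs_rnP (f x) _)); exists (rn (f x)) => // z /=.
by apply: contraTneq => ->; rewrite subr0 ltxx.
Qed.

Definition disjoint_fun f g := forall x, f x = 0 \/ g x = 0.

Lemma disjoint_fun_sym f g : disjoint_fun f g -> disjoint_fun g f.
Proof. by move=> fg x; case: (fg x); [right|left]. Qed.

(** At most one of the summands is nonzero. *)
Lemma rn_disjoint_sum (r : seq nat) (v : nat -> F) : uniq r ->
  (forall i, i \in r -> rn (v i) <= 1) ->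
  (forall i j, i \in r -> j \in r -> i != j -> v i = 0 \/ v j = 0) ->
  rn (\sum_(i <- r) v i) <= 1.
Proof.
elim: r => [|i r IH]; first by rewrite big_nil rn0.
rewrite /= => /andP[ir ur] v1 vd; rewrite big_cons.
have [vi0|vi0] := eqVneq (v i) 0.
  rewrite vi0 add0r; apply: IH => // [j jr|j l jr lr].
    by apply: v1; rewrite inE jr orbT.
  by apply: vd; rewrite inE ?jr ?lr orbT.
rewrite big_seq big1 ?addr0 => [|j jr]; first by apply: v1; rewrite mem_head.
have [|||->//|//] := vd j i; rewrite ?inE ?jr ?eqxx ?orbT//.
  by apply: contraNneq ir => <-.
by move=> v0; rewrite v0 eqxx in vi0.
Qed.

Lemma rn_disjoint_sumC (r : seq nat) (d : nat -> CK) : uniq r ->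
  (forall i, i \in r -> rn (d i) <= 1) ->
  (forall i j, i \in r -> j \in r -> i != j -> disjoint_fun (d i) (d j)) ->
  rn (\sum_(i <- r) d i) <= 1.
Proof.
move=> ur d1 dd; apply: rn_supP => // x; rewrite C_sumE.
apply: rn_disjoint_sum => // [i ir|i j ir jr ij]; last exact: dd.
exact: le_trans (rn_point _ _) (d1 i ir).
Qed.

End continuous_functions.

(** * From disjoint sequences to finite disjoint families *)

Section exhaustion.
Context (R : realType) (s : scalar_kind) (K : topologicalType).
Context (cK : compact [set: K]).
Local Notation F := (scalar_field R s).
Local Notation CK := (C_space R s cK).
Context (X : normedModType F) (T : {linear CK -> X}).

Definition disjointly_small := forall d : nat -> CK,
  (forall i, rn (d i) <= 1) ->
  (forall i j, i != j -> disjoint_fun (d i) (d j)) ->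
  forall e, 0 < e -> exists i, rn (T (d i)) <= e.

Definition large_family (O : set K) (e : R) (n : nat) (d : nat -> CK) :=
  [/\ forall i, (i < n)%N -> rn (d i) <= 1,
      forall i, (i < n)%N -> e < rn (T (d i)),
      forall i j, (i < n)%N -> (j < n)%N -> i != j -> disjoint_fun (d i) (d j) &
      forall i, (i < n)%N -> forall x, ~ O x -> d i x = 0].

Definition uniformly_disjointly_small := forall e, 0 < e ->
  exists n, forall d, ~ large_family setT e n d.

Context (C : R) (C0 : 0 < C) (bT : forall f, rn (T f) <= C * rn f).

Let big O e := forall n, exists d, large_family O e n d.

Let const_cts (c : R) : continuous (fun _ : K => c).
Proof. by move=> x; exact: cvg_cst. Qed.

Section cuts.
Context (h : CK) (t : R) (t0 : 0 < t).
Implicit Types g : CK.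

Let low x := t / Num.max (rn (h x)) t.

Let low_cts : continuous low.
Proof.
move=> x; apply: (@cvgM _ _ (nbhs x)); first exact: const_cts.
apply: (@cvgV _ _ (nbhs x)); first by rewrite gt_eqF// lt_max t0 orbT.
apply: (@continuous_max _ _ (fun x => rn (h x)) (fun=> t)).
  exact: rnC_continuous.
exact: const_cts.
Qed.

Let low01 x : 0 < low x <= 1.
Proof.
have m0 : 0 < Num.max (rn (h x)) t by rewrite lt_max t0 orbT.
by rewrite /low divr_gt0//= ler_pdivrMr// mul1r le_max lexx orbT.
Qed.

(** Soft thresholding of h at height t. *)
Definition shrink : CK := h - Cmul low_cts h.

Lemma shrink_dist : rn (h - shrink) <= t.
Proof.
rewrite /shrink subKr; apply: rn_supP => [|x]; first exact: ltW.
have m0 : 0 < Num.max (rn (h x)) t by rewrite lt_max t0 orbT.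
rewrite rn_Cmul ger0_norm; last by case/andP: (low01 x) => /ltW.
by rewrite /low mulrAC ler_pdivrMr// ler_wpM2l ?(ltW t0)// le_max lexx.
Qed.

Lemma rn_shrink x : rn (shrink x) <= rn (h x).
Proof.
have -> : shrink x = emb (1 - low x) * h x.
  by rewrite rmorphB rmorph1 mulrBl mul1r.
rewrite rnM rn_emb; case/andP: (low01 x) => l0 l1.
by rewrite ger0_norm ?subr_ge0// ler_piMl ?rn_ge0//; lra.
Qed.

Lemma shrink_eq0 x : rn (h x) <= t -> shrink x = 0.
Proof.
move=> hx; have -> : shrink x = h x - emb (low x) * h x by [].
by rewrite /low (max_idPr hx) divff ?gt_eqF// rmorph1 mul1r subrr.
Qed.

Let cap x := Num.min (rn (h x) / t) 1.

Let cap_cts : continuous cap.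
Proof.
move=> x; apply: (@continuous_min _ _ (fun x => rn (h x) / t) (fun=> 1)).
  apply: (@cvgM _ _ (nbhs x)).
    exact: rnC_continuous.
  exact: const_cts.
exact: const_cts.
Qed.

Let cap01 x : 0 <= cap x <= 1.
Proof.
by rewrite /cap le_min ge_min lexx orbT ler01 divr_ge0 ?rn_ge0// ltW.
Qed.

(** Subtracting it from g leaves a function that vanishes where h exceeds t, and
    disjoint functions h have disjoint overlaps with g. *)
Definition overlap (g : CK) : CK := Cmul cap_cts g.

Lemma rn_overlap g x : rn (overlap g x) <= rn (g x).
Proof.
rewrite rn_Cmul; case/andP: (cap01 x) => c0 c1.
by rewrite ger0_norm// ler_piMl ?rn_ge0.
Qed.

Lemma overlap_eq0 g x : h x = 0 -> overlap g x = 0.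
Proof.
move=> hx; have -> : overlap g x = emb (cap x) * g x by [].
by rewrite /cap hx rn0 mul0r min_l// rmorph0 mul0r.
Qed.

Lemma rn_overlapC g x : rn ((g - overlap g) x) <= rn (g x).
Proof.
have -> : (g - overlap g) x = emb (1 - cap x) * g x.
  by rewrite rmorphB rmorph1 mulrBl mul1r.
rewrite rnM rn_emb; case/andP: (cap01 x) => c0 c1.
by rewrite ger0_norm ?subr_ge0// ler_piMl ?rn_ge0//; lra.
Qed.

Lemma overlapC_eq0 g x : t < rn (h x) -> (g - overlap g) x = 0.
Proof.
move=> hx; have -> : (g - overlap g) x = g x - emb (cap x) * g x by [].
rewrite /cap min_r ?rmorph1 ?mul1r ?subrr//.
by rewrite ler_pdivlMr// mul1r ltW.
Qed.

Lemma overlapC_eq0l g x : g x = 0 -> (g - overlap g) x = 0.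
Proof.
move=> gx; have -> : (g - overlap g) x = g x - emb (cap x) * g x by [].
by rewrite gx mulr0 subrr.
Qed.

End cuts.

Lemma pigeonhole (N M : nat) (c m : nat -> nat) : (0 < N)%N ->
  (forall i, (i < N)%N -> (m i <= M)%N) ->
  (forall j, (j < N * M)%N -> (c j < N)%N) ->
  exists2 i, (i < N)%N & (m i <= count (fun j => c j == i) (iota 0 (N * M)))%N.
Proof.
move=> N0 mM cN; apply: contrapT => H.
have lt i : (i < N)%N -> (count (fun j => c j == i) (iota 0 (N * M)) < M)%N.
  move=> iN; apply: leq_trans (mM i iN).
  by rewrite ltnNge; apply/negP => ?; apply: H; exists i.
have : (\sum_(0 <= i < N) count (fun j => c j == i) (iota 0 (N * M)) = N * M)%N.
  transitivity (\sum_(0 <= i < N) \sum_(0 <= j < N * M) (c j == i))%N.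
    apply: eq_bigr => i _.
    by rewrite -sumn_count sumnE big_map /index_iota subn0.
  rewrite exchange_big_nat /= -[RHS]subn0 -[RHS]muln1 -sum_nat_const_nat.
  rewrite big_nat [RHS]big_nat; apply: eq_bigr => j /andP[_ jN].
  rewrite big_mkord (bigD1 (Ordinal (cN j jN)))//= eqxx big1// => i.
  by move=> /eqP ij; case: eqP => // cji; case: ij; apply: val_inj.
have : (\sum_(0 <= i < N) (count (fun j => c j == i) (iota 0 (N * M))).+1
         <= \sum_(0 <= i < N) M)%N.
  by rewrite big_nat [leqRHS]big_nat; apply: leq_sum => i /andP[_ /lt].
rewrite sum_nat_const_nat subn0 (eq_bigr _ (fun i _ => esym (addn1 _))).
rewrite big_split /= sum_nat_const_nat subn0 muln1 => + E.
by rewrite E -[leqRHS]addn0 leq_add2l leqNgt N0.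
Qed.


(** Each member of a larger family can be made disjoint from one of N disjoint
    functions at a small cost, and by the pigeonhole principle many members
    become disjoint from the same one. *)
Let step O e eta : big O e -> 0 < eta -> exists h O',
  [/\ rn h <= 1, e - eta < rn (T h), forall x, ~ O x -> h x = 0,
      O' `<=` O /\ forall x, O' x -> h x = 0 & big O' (e - eta)].
Proof.
move=> Obig eta0.
pose t := eta / C; have t0 : 0 < t by rewrite divr_gt0.
pose N := Num.bound (C / eta).
have CN : C < eta *+ N.
  rewrite -mulr_natl -ltr_pdivrMr//; apply: archi_boundP.
  by rewrite divr_ge0// ltW.
have N0 : (0 < N)%N.
  by case: (N) CN => //; rewrite mulr0n => /(lt_trans C0); rewrite ltxx.
have [h [h1 hT hd hO]] := Obig N.
pose Oi i := O `&` [set x | rn (h i x) <= t].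
have [[i [iN bigi]]|nbig] :=
  pselect (exists i, (i < N)%N /\ big (Oi i) (e - eta)).
  exists (shrink (h i) t0), (Oi i); split=> //.
  - apply: rn_supP => // x; apply: le_trans (rn_shrink _ t0 _) _.
    by apply: le_trans (rn_point _ _) (h1 i iN).
  - have := hT i iN; have := bT (h i - shrink (h i) t0).
    have := shrink_dist (h i) t0; rewrite -(ler_pM2l C0).
    rewrite /t mulrCA divff ?gt_eqF// mulr1.
    by have := rnB (T (h i)) (T (shrink (h i) t0)); rewrite -linearB; lra.
  - move=> x Ox; apply: shrink_eq0.
    by rewrite (hO i iN x Ox) rn0 ltW.
  - by split=> [x []//|x [_]]; exact: shrink_eq0.
exfalso.
have /choice[m mP] i : exists m, (i < N)%N ->
    forall d, ~ large_family (Oi i) (e - eta) m d.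
  apply: contrapT => H; apply: nbig; exists i; split.
    rewrite ltnNge; apply/negP => iN; apply: H.
    by exists 0%N; rewrite ltnNge iN.
  move=> m; apply: contrapT => H2; apply: H; exists m => _ d dm.
  by apply: H2; exists d.
pose M := (\sum_(i < N) m i)%N.
have mM i : (i < N)%N -> (m i <= M)%N.
  by move=> iN; rewrite /M (bigD1 (Ordinal iN))//= leq_addr.
have [g [g1 gT gd gO]] := Obig (N * M)%N.
pose rest i f : CK := f - overlap (h i) t f.
(* The overlaps of g j with the h i are disjoint, so their sum has norm at most
   1: cutting out one of them costs at most C / N < eta on average. *)
have /choice[c cP] j : exists i, (j < N * M)%N ->
    (i < N)%N /\ e - eta < rn (T (rest i (g j))).
  have [jN|jN] := ltnP j (N * M); last by exists 0%N.
  apply: contrapT => H.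
  have small i : (i < N)%N -> rn (T (rest i (g j))) <= e - eta.
    move=> iN; rewrite leNgt; apply/negP => ?; apply: H; exists i => _.
    by split.
  have sum_small : rn (\sum_(0 <= i < N) T (rest i (g j))) <= (e - eta) *+ N.
    apply: le_trans (rn_sum _ _) _.
    rewrite -[X in _ *+ X]subn0 -sumr_const_nat big_nat [leRHS]big_nat.
    by apply: ler_sum => i /andP[_ iN]; exact: small.
  have sum_over : rn (\sum_(0 <= i < N) overlap (h i) t (g j)) <= 1.
    apply: rn_disjoint_sumC; first exact: iota_uniq.
      move=> i _; apply: rn_supP => // x.
      apply: le_trans (rn_overlap _ t0 _ _) _.
      exact: le_trans (rn_point _ _) (g1 j jN).
    move=> i l; rewrite !mem_index_iota /= => iN lN il x.
    by case: (hd i l iN lN il x) => [hx|hx]; [left|right]; exact: overlap_eq0.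
  have E : \sum_(0 <= i < N) T (rest i (g j)) =
      T (g j) *+ N - T (\sum_(0 <= i < N) overlap (h i) t (g j)).
    rewrite linear_sum -[X in _ *+ X]subn0 -sumr_const_nat -sumrB.
    by apply: eq_bigr => i _; rewrite linearB.
  move: sum_small; rewrite E => sum_small.
  have := rnB (T (g j) *+ N) (T (\sum_(0 <= i < N) overlap (h i) t (g j))).
  have -> : rn (T (g j) *+ N) = rn (T (g j)) *+ N.
    rewrite -mulr_natl -[in LHS]scaler_nat.
    have -> : N%:R = emb N%:R :> F by rewrite rmorph_nat.
    by rewrite rnZ ger0_norm.
  have := bT (\sum_(0 <= i < N) overlap (h i) t (g j)).
  move: sum_over; rewrite -(ler_pM2l C0) mulr1.
  have : e *+ N < rn (T (g j)) *+ N by rewrite ltrMn2r N0 gT.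
  by move: sum_small CN; rewrite mulrnBl; lra.
have [i iN ci] := pigeonhole N0 mM (fun j jN => (cP j jN).1).
pose r := [seq j <- iota 0 (N * M) | c j == i].
have rP k : (k < m i)%N -> (nth 0%N r k < N * M)%N /\ c (nth 0%N r k) = i.
  move=> km; have : nth 0%N r k \in r.
    by rewrite mem_nth// size_filter (leq_trans km).
  by rewrite mem_filter mem_iota /= add0n => /andP[/eqP].
apply: (mP i iN (fun k => rest i (g (nth 0%N r k)))); split.
- move=> k km; have [kN kc] := rP k km.
  apply: rn_supP => // x; apply: le_trans (rn_overlapC _ t0 _ _) _.
  exact: le_trans (rn_point _ _) (g1 _ kN).
- by move=> k km; have [kN kc] := rP k km; rewrite -{1}kc; exact: (cP _ kN).2.
- move=> k l km lm kl x; have [kN kc] := rP k km; have [lN lc] := rP l lm.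
  have : nth 0%N r k != nth 0%N r l.
    by rewrite nth_uniq ?filter_uniq ?iota_uniq// size_filter (leq_trans _ ci).
  move=> /(gd _ _ kN lN)/(_ x)[]gx; [left|right]; exact: overlapC_eq0l.
- move=> k km x; have [kN kc] := rP k km => Ox.
  have [Oix|hx] := pselect (O x).
    apply: (overlapC_eq0 t0); rewrite ltNge; apply/negP => hx.
    by apply: Ox; split.
  by apply: overlapC_eq0l; exact: gO.
Qed.

(** If there are arbitrarily large finite families of disjoint functions on
    which T is large, one can split off one function at a time and keep such
    families in what is left. *)
Lemma disjointly_small_uniform :
  disjointly_small -> uniformly_disjointly_small.
Proof.
move=> ds e e0; apply: contrapT => H.
have big0 : big setT e.
  move=> n; apply: contrapT => Hn; apply: H; exists n => d dn.
  by apply: Hn; exists d.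
(* The thresholds decrease, but stay above e / 2. *)
pose S := {p : set K * R | big p.1 p.2 /\ e / 2 < p.2}.
pose next (p q : S) := exists h : CK, [/\ rn h <= 1, e / 2 < rn (T h),
  forall x, ~ (sval p).1 x -> h x = 0, (sval q).1 `<=` (sval p).1 &
  forall x, (sval q).1 x -> h x = 0].
have e2 : e / 2 < e by lra.
have [p|p [_ pP]] :=
  @dependent_choice S next _ (exist _ (setT, e) (conj big0 e2)).
  apply: cid; case: p => [[U e'] /= [Obig e'2]].
  have eta0 : 0 < (e' - e / 2) / 2 by lra.
  have [h [U' [h1 hT hO [U'U hU'] U'big]]] := step Obig eta0.
  have e'e : e / 2 < e' - (e' - e / 2) / 2 by lra.
  exists (exist _ (U', e' - (e' - e / 2) / 2) (conj U'big e'e)).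
  by exists h; split=> //=; exact: lt_trans hT.
have /choice[d dP] := pP.
pose O i := (sval (p i)).1.
have Olt i j : (i < j)%N -> O j `<=` O i.+1.
  elim: j => // j IH; rewrite ltnS leq_eqVlt => /predU1P[<-//|/IH].
  by apply: subset_trans; have [] := dP j.
have dlt i j : (i < j)%N -> disjoint_fun (d i) (d j).
  move=> /Olt Oij x; have [_ _ djO _ _] := dP j; have [_ _ _ _ diO] := dP i.
  have [Ojx|Ojx] := pselect (O j x); last by right; exact: djO.
  by left; apply: diO; exact: Oij.
have e20 : 0 < e / 2 by lra.
have [||i] := ds d _ _ _ e20.
- by move=> i; have [] := dP i.
- move=> i j; rewrite neq_ltn => /orP[/dlt//|/dlt].
  exact: disjoint_fun_sym.
by have [_ dT _ _ _] := dP i; rewrite leNgt dT.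
Qed.

End exhaustion.

(** * Weak convergence *)

Section weak_convergence.
Context (R : realType) (s : scalar_kind).
Local Notation F := (scalar_field R s).
Context (X : normedModType F).

Lemma weak_cvgP (G : set_system X) (x : X) : Filter G ->
  G --> (x : weak_topology X) <->
  forall phi : {linear X -> F^o}, continuous phi -> phi @ G --> phi x.
Proof.
move=> FG; rewrite cvg_sup; split=> [H phi cphi|H [phi cphi]].
  apply: cvg_trans (@initial_continuous _ _ phi x).
  exact: cvg_app (H (exist _ phi cphi)).
move=> A; rewrite /= => -[_ [[B Bo <-] Bx] BA].
apply: filterS BA _; apply: (H phi cphi).
exact: open_nbhs_nbhs.
Qed.

Lemma weak_cvg_dual_ball (G : set_system X) (x : X) (f : X -> R) :
  Filter G -> G --> (x : weak_topology X) -> dual_ball f -> f @ G --> f x.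
Proof.
move=> FG /weak_cvgP Gx /dual_ball_rpart[phi cphi phif].
have -> : f = rpart \o phi by apply/funext => y; rewrite /= phif.
by apply: continuous_cvg (Gx phi cphi); exact: rpart_continuous.
Qed.

Lemma ultra_bounded_cvg (I : Type) (U : set_system I) (f : I -> R) (M : R) :
  UltraFilter U -> (forall i, `|f i| <= M) -> exists l : R, f @ U --> l.
Proof.
move=> UU fM.
have FM : (f @ U) `[- M, M]%classic.
  by apply: (@filterE _ U) => i /=; rewrite in_itv /= -ler_norml.
have [l [_ fl]] := segment_compact (fmap_proper_filter f _) FM.
exists l => A lA; have [//|UnA] := in_ultra_setVsetC (f @^-1` A) UU.
by have [y []] := fl _ _ (UnA : (f @ U) (~` A)) lA.
Qed.

(** The dual ball is compact for pointwise convergence. *)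
Lemma ultra_dual_ball (U : set_system nat) (f : nat -> X -> R) :
  UltraFilter U -> (forall n, dual_ball (f n)) ->
  exists2 g, dual_ball g & forall x, f ^~ x @ U --> g x.
Proof.
move=> UU cf.
have fle n x : `|f n x| <= rn x by have [_ _] := cf n.
have /choice[g gP] x := ultra_bounded_cvg UU (fle ^~ x).
exists g => //; split=> [x y|a x|x].
- apply: (@cvg_unique _ _ ((fun n => f n (x + y)) @ U)) => //.
    exact: gP.
  rewrite (_ : (fun n => _) = f^~ x \+ f^~ y); first exact: cvgD.
  by apply/funext => n; have [-> _ _] := cf n.
- apply: (@cvg_unique _ _ ((fun n => f n (emb a *: x)) @ U)) => //.
    exact: gP.
  rewrite (_ : (fun n => _) = (fun n => a * f n x)); first exact: cvgMr.
  by apply/funext => n; have [_ -> _] := cf n.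
- have /cvg_norm gx := gP x.
  by apply: (cvgr_to_le gx); apply: (@filterE _ U) => n; exact: fle.
Qed.

End weak_convergence.

(** * Disjoint sequences with large images *)

Section almost_biorthogonal.
Context (R : realType) (s : scalar_kind) (K : topologicalType).
Context (cK : compact [set: K]).
Local Notation F := (scalar_field R s).
Local Notation CK := (C_space R s cK).
Context (X : normedModType F) (T : {linear CK -> X}).
Context (C : R) (C0 : 0 < C) (bT : forall f, rn (T f) <= C * rn f).

Definition almost_biorthogonal e (d : nat -> CK) (psi : nat -> X -> R) :=
  [/\ forall i, rn (d i) <= 1,
      forall i j, i != j -> disjoint_fun (d i) (d j),
      forall n, dual_ball (psi n),
      forall n, e <= psi n (T (d n)) &
      forall n (r : seq nat), uniq r -> n \notin r ->
        \sum_(k <- r) `|psi n (T (d k))| <= e / 4].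

(** The rows |psi n (T (d k))| have sums at most C: with suitable signs, the
    functions d k add up to a function of norm at most 1. So Rosenthal's lemma
    applies. *)
Lemma not_disjointly_small : ~ disjointly_small T ->
  exists e d psi, 0 < e /\ almost_biorthogonal e d psi.
Proof.
move=> nds.
have [d [e [e0 d1 dd dT]]] : exists (d : nat -> CK) (e : R), [/\ 0 < e,
    forall i, rn (d i) <= 1,
    forall i j, i != j -> disjoint_fun (d i) (d j) &
    forall i, e < rn (T (d i))].
  apply: contrapT => H; apply: nds => d d1 dd e e0.
  apply: contrapT => H2; apply: H; exists d, e; split=> // i.
  by rewrite ltNge; apply/negP => ?; apply: H2; exists i.
have /choice[psi psiP] i : exists f, dual_ball f /\ f (T (d i)) = rn (T (d i)).
  by have [f cf fE] := norming_dual_ball (T (d i)); exists f.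
have e40 : 0 < e / 4 by lra.
have [|n r ur|f fI fP] :=
  @rosenthal R (fun n k => `|psi n (T (d k))|) C _ _ _ e40.
- by [].
- pose sd k : CK := emb (Num.sg (psi n (T (d k)))) *: d k.
  have -> : \sum_(k <- r) `|psi n (T (d k))| = psi n (T (\sum_(k <- r) sd k)).
    rewrite linear_sum dual_ball_sum; last exact: (psiP n).1.
    apply: eq_bigr => k _; rewrite linearZ_LR; have [_ -> _] := (psiP n).1.
    by rewrite normrEsg.
  have [_ _ ple] := (psiP n).1.
  apply: le_trans (ler_norm _) _; apply: le_trans (ple _) _.
  apply: le_trans (bT _) _; rewrite -[leRHS]mulr1 ler_pM2l//.
  apply: rn_disjoint_sumC => // [k _|k l _ _ kl x].
    rewrite rnZ normr_sg -[leRHS]mulr1 ler_pM ?rn_ge0//.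
    by case: (_ != _).
  by case: (dd k l kl x) => dx; [left|right]; rewrite /sd /= /mkcts dx mulr0.
exists e, (d \o f), (psi \o f); split=> //; split=> //=.
- by move=> i j ij; apply: dd; rewrite inj_eq.
- by move=> n; exact: (psiP _).1.
- by move=> n; rewrite (psiP _).2 ltW.
Qed.

Section partial_sums.
Context (e : R) (d : nat -> CK) (psi : nat -> X -> R) (e0 : 0 < e).
Context (dpsi : almost_biorthogonal e d psi).
Let d1 : forall i, rn (d i) <= 1. Proof. by case: dpsi. Qed.
Let dd : forall i j, i != j -> disjoint_fun (d i) (d j).
Proof. by case: dpsi. Qed.
Let cpsi n : dual_ball (psi n). Proof. by case: dpsi. Qed.
Let psid n : e <= psi n (T (d n)). Proof. by case: dpsi. Qed.
Let psioff n (r : seq nat) : uniq r -> n \notin r ->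
  `|psi n (T (\sum_(k <- r) d k))| <= e / 4.
Proof.
move=> ur nr; case: dpsi => _ _ _ _ /(_ n r ur nr); apply: le_trans.
by rewrite linear_sum dual_ball_sum// ler_norm_sum.
Qed.

Let g m : CK := \sum_(0 <= k < m) d k.

Let rn_g m : rn (g m) <= 1.
Proof.
apply: rn_disjoint_sumC => [|k _|k l _ _]; [exact: iota_uniq|exact: d1|].
exact: dd.
Qed.

Let psi_g_lt n m : (n < m)%N -> 3 / 4 * e <= psi n (T (g m)).
Proof.
move=> nm.
have -> : g m = d n + \sum_(k <- rem n (index_iota 0 m)) d k.
  transitivity (\sum_(k <- n :: rem n (index_iota 0 m)) d k).
    by apply: perm_big; apply: perm_to_rem; rewrite mem_index_iota.
  by rewrite big_cons.
rewrite linearD; have [-> _ _] := cpsi n.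
have := @psioff n (rem n (index_iota 0 m)).
rewrite rem_uniq ?iota_uniq// mem_rem_uniqF ?iota_uniq// => /(_ isT isT).
by rewrite ler_norml => /andP[+ _]; have := psid n; lra.
Qed.

Let psi_g_ge n m : (m <= n)%N -> `|psi n (T (g m))| <= e / 4.
Proof.
move=> mn; apply: psioff; first exact: iota_uniq.
by rewrite mem_index_iota -leqNgt.
Qed.

Let g_dist n m : (n < m)%N -> e / 2 <= rn (T (g n) - T (g m)).
Proof.
move=> nm; rewrite rn_dist; have [_ _ ple] := cpsi n.
apply: le_trans (le_trans (ler_norm _) (ple _)).
rewrite dual_ballB//; have := psi_g_lt nm.
by have := psi_g_ge (leqnn n); rewrite ler_norml => /andP[_]; lra.
Qed.

Let g_prec n m : (n < m)%N -> prec (g n) (g m).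
Proof.
move=> nm; split.
  by move=> gnm; have := g_dist nm; rewrite gnm subrr rn0 leNgt divr_gt0.
move=> x gx; have -> : g m = g n + \sum_(n <= k < m) d k.
  by rewrite /g -big_cat_nat//= ltnW.
rewrite -[LHS]addr0; congr (_ + _); apply/esym.
transitivity (\sum_(n <= k < m) d k x); first exact: C_sumE.
apply: big1_seq => k /=; rewrite mem_index_iota => /andP[nk _].
have [//|dkx] := eqVneq (d k x) 0.
have [y [/eqP gy /eqP dky]] := gx _ (C_neq0_nbhs dkx).
case: gy; rewrite C_sumE; apply: big1_seq => j /=.
rewrite mem_index_iota => jn.
have [|//|] := @dd j k _ y; last by move/dky.
by rewrite ltn_eqF// (leq_trans jn).
Qed.

(** The chain of partial sums is separated by the functionals psi n. *)
Lemma almost_biorthogonal_chain : ~ infinite_chain_condition T.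
Proof.
have gI : injective g.
  move=> n m gnm; apply/eqP; case: ltngtP => // /g_dist;
  by rewrite gnm subrr rn0 leNgt divr_gt0.
move=> /(_ (range g)) [|||_ lb].
- have /eq_finite_set -> : (range g #= [set: nat])%card.
    by apply: inj_card_eq => n m _ _; exact: gI.
  exact: infinite_nat.
- move=> _ _ [n _ <-] [m _ <-] gnm; case: (ltngtP n m) => nm.
  + by left; exact: g_prec.
  + by right; exact: g_prec.
  + by case: gnm; rewrite nm.
- exists 1; split; first exact: real1.
  move=> M /ltW M1 _ [n _ <-] /=; apply: le_trans M1.
  by rewrite -rnE -(rmorph1 (@emb R s)) ler_emb; exact: rn_g.
have : emb (e / 2) <= 0 :> F.
  apply: lb => z [_ [_ [[n _ <-] [m _ <-] gnm ->]]].
  rewrite -rnE ler_emb; case: (ltngtP n m) => nm.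
  + exact: g_dist.
  + by rewrite rn_dist g_dist.
  + by case: gnm; rewrite nm.
by rewrite -(rmorph0 (@emb R s)) ler_emb leNgt divr_gt0.
Qed.

(** A pointwise cluster point of the psi n is small at all T (g m), but large at
    a weak cluster point of these. *)
Lemma almost_biorthogonal_weakly_compact : ~ weakly_compact T.
Proof.
move=> [A TA [cA _]].
pose y m : X := T (g m).
have [G [UG yG]] := ultraFilterLemma (@fmap_proper_filter _ _ y \oo _).
have GA : G A.
  apply: yG; apply: (@filterE _ \oo) => m; apply: TA; exists (g m) => //=.
  by rewrite -rnE -(rmorph1 (@emb R s)) ler_emb; exact: rn_g.
move: cA; rewrite compact_ultra => /(_ G UG GA)[x [_ Gx]].
have psix n : 3 / 4 * e <= psi n x.
  apply: (cvgr_to_ge (weak_cvg_dual_ball _ Gx (cpsi n))).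
  by apply: yG; exists n.+1 => // m /= nm; exact: psi_g_lt.
have [U [UU ooU]] := ultraFilterLemma (eventually_filter).
have [f cf fP] := ultra_dual_ball UU cpsi.
have fx : 3 / 4 * e <= f x.
  by apply: (cvgr_to_ge (fP x)); apply: (@filterE _ U) => n; exact: psix.
have fy m : f (y m) <= e / 4.
  apply: (cvgr_to_le (fP (y m))); apply: ooU; exists m => // n /= mn.
  by have := psi_g_ge mn; rewrite ler_norml => /andP[].
have : f x <= e / 4.
  apply: (cvgr_to_le (weak_cvg_dual_ball _ Gx cf)).
  by apply: yG; apply: (@filterE _ \oo) => m; exact: fy.
by rewrite leNgt => /negP; apply; apply: lt_le_trans fx; have := e0; lra.
Qed.

End partial_sums.

End almost_biorthogonal.

(** * Chains *)

Section chains.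
Context (R : realType) (s : scalar_kind) (K : topologicalType).
Context (cK : compact [set: K]).
Local Notation F := (scalar_field R s).
Local Notation CK := (C_space R s cK).
Implicit Types f g h : CK.

Lemma prec_neq0 f g x : prec f g -> f x != 0 -> f x = g x.
Proof. by move=> [_ fg] fx; apply: fg; exact: subset_closure. Qed.

Lemma prec_trans f g h : prec f g -> prec g h -> prec f h.
Proof.
move=> fg gh; have sfg : supp f `<=` supp g.
  apply: closureS => x /= fx; rewrite -(prec_neq0 fg)//.
split=> [fh|x sfx]; last by rewrite fg.2// gh.2//; exact: sfg.
case: fg => + fg; apply; apply/continuousEP => x.
have [gx|gx] := eqVneq (g x) 0; last by rewrite fh (prec_neq0 gh).
have [fx|fx] := eqVneq (f x) 0; first by rewrite gx.
by rewrite fg//; exact: subset_closure.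
Qed.

Context (X : normedModType F) (T : {linear CK -> X}).

(** Consecutive differences along a chain are disjoint: if f precedes g and
    g - f does not vanish at x, then neither does g, so the members of the chain
    above g agree at x. Hence n + 1 members of the chain suffice, where n bounds
    the size of disjoint families with large images. *)
Lemma uniformly_disjointly_small_chain :
  uniformly_disjointly_small T -> infinite_chain_condition T.
Proof.
move=> uds A Ainf Ach Abnd.
have [M M0 AM] : exists2 M : R, 0 < M & forall f, A f -> rn f <= M.
  have /pinfty_ex_gt0[M M0 AM] := Abnd; exists (rpart M) => [|f Af].
    by rewrite -(ltr_emb s) rmorph0 rpartK// ltW.
  by rewrite -(ler_emb s) rnE rpartK ?AM// ltW.
pose le f g := `[< f = g \/ prec f g >].
have le_neq0 f g x : le f g -> f x != 0 -> f x = g x.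
  by move=> /asboolP[->//|fg]; exact: prec_neq0.
have le_trans' : transitive le.
  move=> g f h /asboolP[->//|fg] /asboolP[<-|gh]; apply/asboolP; right => //.
  exact: prec_trans fg gh.
have close (e : R) : 0 < e ->
    exists f g, [/\ A f, A g, f <> g & rn (T f - T g) <= e].
  move=> e0; have e'0 : 0 < e / (2 * M) by rewrite divr_gt0// mulr_gt0.
  have [n large] := uds _ e'0.
  have [B BA nB] := infinite_set_fset n.+1 Ainf.
  pose l := sort le (finmap.enum_fset B).
  have lA : all (mem A) l.
    by apply/allP => f; rewrite mem_sort => fB; apply/mem_set/BA.
  have lsort : sorted le l.
    apply: (@sort_sorted_in _ (mem A)); last first.
      by apply/allP => f fB; apply/mem_set/BA.
    move=> f g /set_mem Af /set_mem Ag.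
    have [<-|fg] := pselect (f = g).
      by rewrite /le orbb; apply/asboolP; left.
    have [?|?] := Ach f g Af Ag fg; apply/orP; [left|right];
      by apply/asboolP; right.
  have nl : (n < size l)%N by rewrite size_sort.
  have ul : uniq l by rewrite sort_uniq finmap.fset_uniq.
  pose f i := nth 0 l i.
  have fA i : (i <= n)%N -> A (f i).
    move=> iN; apply/set_mem/(allP lA)/mem_nth; exact: leq_ltn_trans nl.
  have fle i j : (i <= j)%N -> (j <= n)%N -> le (f i) (f j).
    rewrite leq_eqVlt => /predU1P[->|ij jn].
      by move=> _; apply/asboolP; left.
    apply: (@sorted_ltn_nth _ le le_trans' 0 l lsort) => //; rewrite inE.
      exact: leq_ltn_trans (ltnW ij) (leq_ltn_trans jn nl).
    exact: leq_ltn_trans nl.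
  pose d i : CK := emb (2 * M)^-1 *: (f i.+1 - f i).
  have dE i x : d i x = emb (2 * M)^-1 * (f i.+1 x - f i x) by [].
  have dlt i j x : (i < j)%N -> (j < n)%N -> d i x = 0 \/ d j x = 0.
    move=> ij jn; have [fx|fx] := eqVneq (f i.+1 x) 0.
      left; rewrite dE fx sub0r.
      have [->|fix0] := eqVneq (f i x) 0; first by rewrite oppr0 mulr0.
      have fii := fle i i.+1 (leqnSn i) (leq_trans ij (ltnW jn)).
      have := le_neq0 _ _ _ fii fix0.
      by rewrite fx => ->; rewrite oppr0 mulr0.
    right; rewrite dE.
    rewrite -(le_neq0 _ _ _ (fle i.+1 j ij (ltnW jn)) fx).
    by rewrite -(le_neq0 _ _ _ (fle i.+1 j.+1 (leqW ij) jn) fx) subrr mulr0.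
  have /existsNP[i /not_implyP[iN dT]] :
      ~ forall i, (i < n)%N -> e / (2 * M) < rn (T (d i)).
    move=> dT; apply: (large d); split=> // [i iN|i j iN jN|i _ x []//].
      rewrite rnZ gtr0_norm ?invr_gt0 ?mulr_gt0// ler_pdivrMl ?mulr_gt0// mulr1.
      apply: le_trans (rnD _ _) _; rewrite rnN.
      by have := AM _ (fA i.+1 iN); have := AM _ (fA i (ltnW iN)); lra.
    rewrite neq_ltn => /orP[ij|ji] x; first exact: dlt.
    by have [] := dlt j i x ji iN; [right|left].
  exists (f i.+1), (f i); split; [exact: fA|apply: fA; exact: ltnW| |].
    have i1n := leq_ltn_trans iN nl; move/eqP.
    by rewrite nth_uniq// ?gtn_eqF// (leq_ltn_trans _ i1n).
  move/negP: dT; rewrite -leNgt linearZ_LR rnZ gtr0_norm ?invr_gt0 ?mulr_gt0//.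
  by rewrite mulrC ler_pM2r ?invr_gt0 ?mulr_gt0// linearB.
split=> [_ [f [g [_ _ _ ->]]]//|z zlb].
have zle e : 0 < e -> z <= emb e.
  move=> /close[f [g [Af Ag fg fge]]]; apply: le_trans (zlb _ _) _.
    by exists f, g.
  by rewrite -rnE ler_emb.
(* The lower bound z is a real scalar, since it is comparable with 1. *)
have zE : z = emb (1 - rpart (emb 1 - z)).
  by rewrite rmorphB /= rpartK ?subKr// subr_ge0 zle.
rewrite zE -(rmorph0 (@emb R s)) ler_emb.
by apply/ler_addgt0Pr => e e0; rewrite add0r -(ler_emb s) -zE zle.
Qed.

End chains.

(** * The modulus of a functional *)

Section modulus.
Context (R : realType) (s : scalar_kind) (K : topologicalType).
Context (cK : compact [set: K]).
Local Notation F := (scalar_field R s).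
Local Notation CK := (C_space R s cK).
Implicit Types (f g h : CK) (u v w : K -> R).
Context (X : normedModType F) (T : {linear CK -> X}).
Context (C : R) (C0 : 0 < C) (bT : forall f, rn (T f) <= C * rn f).

Definition dominated u f := forall x, rn (f x) <= u x.

Definition weight u :=
  [/\ continuous u, forall x, 0 <= u x & exists M, forall x, u x <= M].

Lemma weightD u v : weight u -> weight v -> weight (fun x => u x + v x).
Proof.
move=> [cu u0 [M uM]] [cv v0 [N vN]]; split.
- by move=> x; apply: cvgD; [exact: cu|exact: cv].
- by move=> x; rewrite addr_ge0.
- by exists (M + N) => x; rewrite lerD.
Qed.

Lemma weightZ c u : 0 <= c -> weight u -> weight (fun x => c * u x).
Proof.
move=> c0 [cu u0 [M uM]]; split.
- by move=> x; apply: cvgM; [exact: cvg_cst|exact: cu].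
- by move=> x; rewrite mulr_ge0.
- by exists (c * M) => x; rewrite ler_wpM2l.
Qed.

Lemma weight_cst c : 0 <= c -> weight (fun=> c).
Proof. by move=> c0; split=> //; [move=> x; exact: cvg_cst|exists c]. Qed.

Lemma weight_rn f : weight (fun x => rn (f x)).
Proof.
split; [exact: rnC_continuous|move=> x; exact: rn_ge0|].
by exists (rn f) => x; exact: rn_point.
Qed.

Lemma weight_sqr f : weight (fun x => rn (f x) ^+ 2).
Proof.
have [cf f0 [M fM]] := weight_rn f; split.
- by move=> x; rewrite /continuous_at expr2; under eq_fun do rewrite expr2;
    apply: cvgM; exact: cf.
- by move=> x; rewrite sqr_ge0.
- by exists (M ^+ 2) => x; rewrite lerXn2r ?nnegrE// (le_trans (f0 x)).
Qed.

Lemma weight_sum (I : Type) (r : seq I) (u : I -> K -> R) :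
  (forall i, weight (u i)) -> weight (fun x => \sum_(i <- r) u i x).
Proof.
move=> wu; elim: r => [|i r IH].
  by under eq_fun do rewrite big_nil; exact: weight_cst.
by under eq_fun do rewrite big_cons; exact: weightD.
Qed.

Lemma weight_max0 u : continuous u -> (exists M, forall x, u x <= M) ->
  weight (fun x => Num.max (u x) 0).
Proof.
move=> cu [M uM]; split.
- move=> x; apply: (@continuous_max _ _ u (fun=> 0)); first exact: cu.
  exact: cvg_cst.
- by move=> x; rewrite le_max lexx orbT.
- by exists (Num.max M 0) => x; rewrite ge_max !le_max uM lexx orbT.
Qed.

(** The integral of u against the total variation of the measure that represents
    psi \o T. *)
Definition modulus (psi : X -> R) u :=
  sup [set psi (T g) | g in dominated u].

Section one_functional.
Context (psi : X -> R) (cpsi : dual_ball psi).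

Let dominated_le u M g : 0 <= M -> (forall x, u x <= M) -> dominated u g ->
  `|psi (T g)| <= C * M.
Proof.
move=> M0 uM gu; have [_ _ ple] := cpsi.
apply: le_trans (ple _) (le_trans (bT _) _); rewrite ler_pM2l//.
by apply: rn_supP => // x; exact: le_trans (gu x) (uM x).
Qed.

Lemma modulus_ge u g : weight u -> dominated u g ->
  psi (T g) <= modulus psi u.
Proof.
move=> [_ u0 [M uM]] gu; apply: ub_le_sup; last by exists g.
exists (C * Num.max M 0) => _ [h hu <-].
apply: le_trans (ler_norm _) (dominated_le _ _ hu).
  by rewrite le_max lexx orbT.
by move=> x; rewrite le_max uM.
Qed.

Lemma modulus_le u b : weight u ->
  (forall g, dominated u g -> psi (T g) <= b) -> modulus psi u <= b.
Proof.
move=> [_ u0 _] ub; apply: ge_sup => [|_ [g gu <-]]; last exact: ub.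
by exists (psi (T 0)), 0 => // x; rewrite rn0.
Qed.

Lemma modulus_ge0 u : weight u -> 0 <= modulus psi u.
Proof.
move=> wu; have <- : psi (T 0) = 0 by rewrite linear0 dual_ball0.
by apply: modulus_ge => // x; rewrite rn0; have [] := wu.
Qed.

Lemma modulus_leM u M : weight u -> 0 <= M -> (forall x, u x <= M) ->
  modulus psi u <= C * M.
Proof.
move=> wu M0 uM; apply: modulus_le => // g gu.
exact: le_trans (ler_norm _) (dominated_le M0 uM gu).
Qed.

Lemma modulus_mono u v : weight u -> weight v -> (forall x, u x <= v x) ->
  modulus psi u <= modulus psi v.
Proof.
move=> wu wv uv; apply: modulus_le => // g gu; apply: modulus_ge => // x.
exact: le_trans (gu x) (uv x).
Qed.

Lemma modulus_superadditive u v : weight u -> weight v ->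
  modulus psi u + modulus psi v <= modulus psi (fun x => u x + v x).
Proof.
move=> wu wv; rewrite -lerBrDr; apply: modulus_le => // g gu.
rewrite lerBrDr addrC -lerBrDr; apply: modulus_le => // h hv.
rewrite lerBrDr; have [<- _ _] := cpsi; rewrite -linearD.
apply: modulus_ge => [|x]; first exact: weightD.
by apply: le_trans (rnD _ _) _; rewrite addrC lerD.
Qed.

(** A function dominated by u + v is split in the proportion u : v; the
    regularization by eta keeps the two parts continuous where u + v
    vanishes, and leaves a remainder of norm at most eta. *)
Lemma modulus_subadditive u v : weight u -> weight v ->
  modulus psi (fun x => u x + v x) <= modulus psi u + modulus psi v.
Proof.
move=> wu wv; have [cu u0 _] := wu; have [cv v0 _] := wv.
apply: modulus_le => [|g guv]; first exact: weightD.
apply/ler_addgt0Pr => e e0.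
have eta0 : 0 < e / C by rewrite divr_gt0.
pose q (w : K -> R) x := w x / (u x + v x + e / C).
have den0 x : 0 < u x + v x + e / C by rewrite ltr_wpDl// addr_ge0.
have cq w : continuous w -> continuous (q w).
  move=> cw x; apply: cvgM; first exact: cw.
  apply: cvgV; first by rewrite gt_eqF.
  by apply: cvgD; [apply: cvgD; [exact: cu|exact: cv]|exact: cvg_cst].
pose gu := Cmul (cq _ cu) g; pose gv := Cmul (cq _ cv) g.
have dom w (cw : continuous w) : (forall x, 0 <= w x) ->
    dominated w (Cmul (cq w cw) g).
  move=> w0 x; rewrite rn_Cmul /q ger0_norm; last first.
    by rewrite divr_ge0// ltW.
  rewrite mulrAC ler_pdivrMr// ler_wpM2l//.
  by apply: le_trans (guv x) _; rewrite lerDl ltW.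
have rest : rn (g - gu - gv) <= e / C.
  apply: rn_supP => [|x]; first exact: ltW.
  have -> : (g - gu - gv) x = emb (e / C / (u x + v x + e / C)) * g x.
    have -> : (g - gu - gv) x =
        g x - emb (q u x) * g x - emb (q v x) * g x by [].
    rewrite -[g x in X in X - _ - _]mul1r -!mulrBl; congr (_ * _).
    rewrite -[1](rmorph1 (@emb R s)) -!rmorphB /=; congr emb.
    have D0 : u x + v x + e / C != 0 by rewrite gt_eqF.
    by rewrite /q -(divff D0) -!mulrBl; congr (_ / _); ring.
  rewrite rnM rn_emb ger0_norm; last by rewrite divr_ge0// ltW.
  rewrite mulrAC ler_pdivrMr// ler_wpM2l// ?(ltW eta0)//.
  by apply: le_trans (guv x) _; rewrite lerDl ltW.
have gE : g = gu + gv + (g - gu - gv).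
  by rewrite -[g - gu - gv]addrA -opprD [RHS]addrC subrK.
move: rest gE; move: (g - gu - gv) => r rest ->.
have [pD _ ple] := cpsi; rewrite !linearD !pD; apply: lerD; last first.
  apply: le_trans (ler_norm _) (le_trans (ple _) (le_trans (bT _) _)).
  by rewrite -ler_pdivlMl// mulrC.
by apply: lerD; apply: modulus_ge => //; exact: dom.
Qed.

Lemma modulusZ_le c u : 0 <= c -> weight u ->
  modulus psi (fun x => c * u x) <= c * modulus psi u.
Proof.
move=> cge0 wu; have [->|cn0] := eqVneq c 0.
  rewrite mul0r -[leRHS](mulr0 C); apply: modulus_leM => // [|x].
    by apply: weightZ.
  by rewrite mul0r.
have c0 : 0 < c by rewrite lt_neqAle eq_sym cn0.
apply: modulus_le => [|g gu]; first exact: weightZ.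
rewrite -ler_pdivrMl//; have [_ pZ _] := cpsi.
rewrite -pZ -linearZ_LR; apply: modulus_ge => // x.
have -> : (emb c^-1 *: g) x = emb c^-1 * g x by [].
by rewrite rnM rn_emb gtr0_norm ?invr_gt0// ler_pdivrMl.
Qed.

Lemma modulus_sum_le (I : Type) (r : seq I) (u : I -> K -> R) :
  (forall i, weight (u i)) ->
  modulus psi (fun x => \sum_(i <- r) u i x) <=
  \sum_(i <- r) modulus psi (u i).
Proof.
move=> wu; elim: r => [|i r IH].
  rewrite big_nil -[leRHS](mulr0 C); apply: modulus_leM => // [|x].
    exact: weight_sum.
  by rewrite big_nil.
rewrite big_cons; under eq_fun do rewrite big_cons.
apply: le_trans (modulus_subadditive (wu i) (weight_sum r wu)) _.
by rewrite lerD2l.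
Qed.

(** The parallelogram law for the seminorm of L^2 of the modulus. *)
Lemma modulus_parallelogram f g :
  modulus psi (fun x => rn ((emb 2^-1 *: (f - g)) x) ^+ 2) +
  modulus psi (fun x => rn ((emb 2^-1 *: (f + g)) x) ^+ 2) <=
  (modulus psi (fun x => rn (f x) ^+ 2) +
   modulus psi (fun x => rn (g x) ^+ 2)) / 2.
Proof.
apply: le_trans (modulus_superadditive _ _) _; try exact: weight_sqr.
have -> : (fun x => rn ((emb 2^-1 *: (f - g)) x) ^+ 2 +
                    rn ((emb 2^-1 *: (f + g)) x) ^+ 2) =
    fun x => 2^-1 * rn (f x) ^+ 2 + 2^-1 * rn (g x) ^+ 2.
  apply/funext => x.
  have -> : (emb 2^-1 *: (f - g)) x = emb 2^-1 * (f x - g x) by [].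
  have -> : (emb 2^-1 *: (f + g)) x = emb 2^-1 * (f x + g x) by [].
  rewrite !rnM rn_emb !exprMn [LHS]addrC -mulrDr rn_parallelogram.
  by rewrite ger0_norm ?invr_ge0//; field.
have h0 : 0 <= 2^-1 :> R by rewrite invr_ge0.
apply: le_trans (modulus_subadditive _ _) _;
  try by apply: weightZ => //; exact: weight_sqr.
rewrite mulrDl ![_ / 2]mulrC.
by apply: lerD; apply: modulusZ_le => //; exact: weight_sqr.
Qed.

End one_functional.
End modulus.

(** * Estimates by quadratic functionals *)

Section estimate.
Context (R : realType) (s : scalar_kind) (K : topologicalType).
Context (cK : compact [set: K]).
Local Notation F := (scalar_field R s).
Local Notation CK := (C_space R s cK).
Implicit Types (f g h : CK) (u v w : K -> R).
Context (X : normedModType F) (T : {linear CK -> X}).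
Context (C : R) (C0 : 0 < C) (bT : forall f, rn (T f) <= C * rn f).

(** The square of the L^2 seminorm of a measure of mass at most 1 has these
    properties; the last one is a form of the parallelogram law. *)
Definition quadratic (Q : CK -> R) := [/\ forall f, rn f <= 1 -> 0 <= Q f,
  forall f, rn f <= 1 -> Q f <= 1 &
  forall f g, rn f <= 1 -> rn g <= 1 ->
    Q (emb 2^-1 *: (f - g)) + Q (emb 2^-1 *: (f + g)) <= (Q f + Q g) / 2].

Let total (l : seq {psi : X -> R | dual_ball psi}) u :=
  \sum_(p <- l) modulus T (sval p) u.

Let sqr f x : R := rn (f x) ^+ 2.

Let wsqr f : weight (sqr f). Proof. exact: weight_sqr. Qed.

Let total_ge0 l u : weight u -> 0 <= total l u.
Proof.
move=> wu; apply: sumr_ge0 => p _.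
exact: (modulus_ge0 C0 bT (svalP p)).
Qed.

Let quadratic_total l :
  quadratic (fun f => total l (sqr f) / (C * (size l).+1%:R)).
Proof.
have D0 : 0 < C * (size l).+1%:R by rewrite mulr_gt0.
split=> [f _|f f1|f g _ _].
- by rewrite divr_ge0 ?total_ge0// ltW.
- rewrite ler_pdivrMr// mul1r.
  apply: (@le_trans _ _ (\sum_(p <- l) C)).
    apply: ler_sum => p _; rewrite -[leRHS]mulr1.
    apply: (modulus_leM C0 bT (svalP p)) => // x.
    rewrite /sqr -(expr1n _ 2) lerXn2r ?nnegrE ?rn_ge0//.
    exact: le_trans (rn_point _ _) f1.
  rewrite big_const_seq count_predT iter_addr_0 -[C *+ _]mulr_natr.
  by rewrite ler_pM2l// ler_nat.
- rewrite -mulrDl -[X in _ <= X / _]mulrDl [leRHS]mulrAC ler_pM2r ?invr_gt0//.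
  rewrite /total -!big_split /= mulr_suml; apply: ler_sum => p _.
  exact: (modulus_parallelogram C0 bT (svalP p)).
Qed.

(** If no sum of moduli of functionals dominates T up to e, then functions f k
    and functionals psi k are found one after the other: T (f k) is large and
    psi k detects it, but f k is small for the moduli of the previous psi i. The
    functions h i arise from |f i| by removing the places where a later f k is
    not small. They are disjoint, and the modulus of psi i hardly notices the
    difference. *)
Lemma quadratic_estimate : uniformly_disjointly_small T -> forall e, 0 < e ->
  exists Q N, quadratic Q /\ forall f, rn f <= 1 -> rn (T f) <= N * Q f + e.
Proof.
move=> uds e e0; apply: contrapT => H.
have e40 : 0 < e / 4 by lra.
have [n large] := uds _ e40.
(* The height t, up to which functions are neglected, costs C t = e / 4. The
   factor c = t^-2 makes c |f k|^2 < 1 equivalent to |f k| < t, and th is so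
   small that n terms c |f k|^2 cost at most e / 4. *)
pose t := e / 4 / C; have t0 : 0 < t by rewrite divr_gt0.
pose c := t^-1 ^+ 2; have c0 : 0 < c by rewrite exprn_gt0// invr_gt0.
pose th := e / 4 / (c * n.+1%:R).
have th0 : 0 < th by rewrite divr_gt0// mulr_gt0.
have next l : exists fp : CK * {psi : X -> R | dual_ball psi},
    [/\ rn fp.1 <= 1, e < sval fp.2 (T fp.1) & total l (sqr fp.1) <= th].
  have [f f1 fT] : exists2 f, rn f <= 1 &
      C / th * total l (sqr f) + e < rn (T f).
    apply: contrapT => Hf; apply: H.
    pose D := C * (size l).+1%:R; have D0 : 0 < D by rewrite mulr_gt0.
    exists (fun f => total l (sqr f) / D), (C / th * D).
    split=> [|f f1]; first exact: quadratic_total.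
    rewrite -mulrA [D * _]mulrCA divff ?gt_eqF// mulr1.
    by rewrite leNgt; apply/negP => ?; apply: Hf; exists f.
  have [psi cpsi psif] := norming_dual_ball (T f).
  exists (f, exist _ psi cpsi); split=> //=.
    apply: le_lt_trans (_ : C / th * total l (sqr f) + e < _); last first.
      by rewrite psif.
    by rewrite lerDr mulr_ge0 ?total_ge0// divr_ge0// ltW.
  have : C / th * total l (sqr f) <= C.
    have := bT f; have : C * rn f <= C by rewrite -[leRHS]mulr1 ler_pM2l.
    by have := fT; have := e0; lra.
  by rewrite mulrAC ler_pdivrMr// ler_pM2l.
have /choice[nx nxP] := next.
pose l := fix l k := if k is k'.+1 then (nx (l k')).2 :: l k' else [::].
pose f k := (nx (l k)).1; pose psi k := (nx (l k)).2.
have cpsi k : dual_ball (sval (psi k)) by exact: svalP.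
have f1 k : rn (f k) <= 1 by have [] := nxP (l k).
have psif k : e < sval (psi k) (T (f k)) by have [] := nxP (l k).
have psi_sqr i k : (i < k)%N -> modulus T (sval (psi i)) (sqr (f k)) <= th.
  move=> ik; have [_ _] := nxP (l k); apply: le_trans.
  move: (sqr _) (wsqr (f k)) => u wu; elim: k ik => // k IH.
  rewrite ltnS leq_eqVlt /= /total big_cons.
  move=> /predU1P[->|/IH ik]; first by rewrite lerDl total_ge0.
  apply: le_trans ik _; rewrite lerDr.
  exact: (modulus_ge0 C0 bT (cpsi k)).
pose S i x := \sum_(i.+1 <= k < n) sqr (f k) x.
have wS i : weight (S i) by exact: weight_sum.
pose h0 i x := rn (f i x) - (c * S i x + t).
pose h i x := Num.max (h0 i x) 0.
have S0 i x : 0 <= S i x by have [_ + _] := wS i; exact.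
have h0le i x : h0 i x <= rn (f i x).
  by rewrite /h0 lerBlDr lerDl addr_ge0// ?(ltW t0)// mulr_ge0// ltW.
have wh i : weight (h i).
  apply: weight_max0.
    have [cS _ _] := wS i; move=> x; apply: cvgB; first exact: rnC_continuous.
    by apply: cvgD; [apply: cvgM; [exact: cvg_cst|exact: cS]|exact: cvg_cst].
  by exists (rn (f i)) => x; apply: le_trans (h0le i x) (rn_point _ _).
have hle i x : h i x <= rn (f i x) by rewrite ge_max h0le rn_ge0.
have hdisj i k x : (i < k)%N -> (k < n)%N -> h i x = 0 \/ h k x = 0.
  move=> ik kn; have [hi|hi] := leP (h0 i x) 0; first by left; exact: max_r.
  right; apply: max_r; rewrite /h0 lerBlDr add0r.
  (* Where h i > 0 one has c |f k|^2 < 1, that is, |f k| < t. *)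
  have fk : sqr (f k) x <= S i x.
    rewrite /S (bigD1_seq k) ?iota_uniq ?mem_index_iota ?ik//=.
    by rewrite lerDl sumr_ge0// => j _; exact: sqr_ge0.
  have : c * sqr (f k) x < 1.
    move: hi; rewrite /h0 subr_gt0 => hi.
    have fi1 := le_trans (rn_point (f i) x) (f1 i).
    have : c * sqr (f k) x <= c * S i x by rewrite ler_pM2l.
    by have := t0; lra.
  rewrite /c /sqr -exprMn -[1](expr1n _ 2) ltr_pXn2r ?nnegrE//; last first.
    by rewrite mulr_ge0 ?rn_ge0// invr_ge0 ltW.
  rewrite mulrC ltr_pdivrMr// mul1r => fkt.
  apply: le_trans (ltW fkt) _; rewrite lerDr.
  by rewrite mulr_ge0 ?S0// ltW.
have hvar i : (i < n)%N -> e / 4 < modulus T (sval (psi i)) (h i).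
  move=> iN; have wcSt : weight (fun x => c * S i x + t).
    apply: weightD; first by apply: weightZ => //; exact: ltW.
    by apply: weight_cst; exact: ltW.
  have V1 : e < modulus T (sval (psi i)) (fun x => rn (f i x)).
    apply: lt_le_trans (psif i) _; apply: (modulus_ge C0 bT) => //.
    exact: weight_rn.
  have V2 : modulus T (sval (psi i)) (fun x => rn (f i x)) <=
      modulus T (sval (psi i)) (fun x => h i x + (c * S i x + t)).
    apply: (modulus_mono C0 bT) => //; [exact: weight_rn|exact: weightD|].
    by move=> x; rewrite -lerBlDr le_max lexx.
  have V3 := modulus_subadditive C0 bT (cpsi i) (wh i) wcSt.
  have V4 : modulus T (sval (psi i)) (fun x => c * S i x + t) <=
      c * (n%:R * th) + C * t.
    apply: le_trans (modulus_subadditive C0 bT (cpsi i) _ _) _.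
    - by apply: weightZ => //; exact: ltW.
    - by apply: weight_cst; exact: ltW.
    apply: lerD; last first.
      by apply: (modulus_leM C0 bT) => //; [apply: weight_cst|]; exact: ltW.
    apply: le_trans (modulusZ_le C0 bT (cpsi i) (ltW c0) (wS i)) _.
    rewrite ler_pM2l//.
    apply: le_trans (modulus_sum_le C0 bT (cpsi i) _ _) _ => //.
    apply: (@le_trans _ _ (\sum_(i.+1 <= k < n) th)).
      rewrite big_nat [leRHS]big_nat; apply: ler_sum => k /andP[ik _].
      exact: psi_sqr.
    by rewrite sumr_const_nat -[th *+ _]mulr_natl ler_pM2r// ler_nat leq_subr.
  have Ct : C * t = e / 4 by rewrite /t mulrCA divff ?mulr1// gt_eqF.
  have cth : c * (n%:R * th) <= e / 4.
    rewrite (_ : c * _ = e / 4 * (n%:R / n.+1%:R)).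
      by rewrite ler_piMr ?(ltW e40)// ler_pdivrMr// mul1r ler_nat.
    rewrite /th; field.
    by rewrite -[1 + _]/(1%:R + _) -natrD pnatr_eq0 (gt_eqF c0).
  by lra.
have /choice[g gP] i : exists g, (i < n)%N ->
    dominated (h i) g /\ e / 4 < sval (psi i) (T g).
  have [iN|iN] := ltnP i n; last by exists 0.
  apply: contrapT => Hg; have := hvar i iN; rewrite ltNge => /negP; apply.
  apply: modulus_le => // g gh; rewrite leNgt; apply/negP => ?.
  by apply: Hg; exists g.
apply: (large g); split=> [i iN|i iN|i k iN kN ik x|i _ x []//].
- apply: rn_supP => // x; apply: le_trans ((gP i iN).1 x) _.
  exact: le_trans (hle i x) (le_trans (rn_point _ _) (f1 i)).
- apply: lt_le_trans (gP i iN).2 _; have [_ _ ple] := cpsi i.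
  exact: le_trans (ler_norm _) (ple _).
- have g0 j : (j < n)%N -> h j x = 0 -> g j x = 0.
    move=> jn hj; apply: rn_eq0; apply/eqP; rewrite eq_le rn_ge0 andbT -hj.
    exact: (gP j jn).1.
  move: ik; rewrite neq_ltn => /orP[ik|ki].
    by case: (hdisj i k x ik kN) => hx; [left|right]; exact: g0.
  by case: (hdisj k i x ki iN) => hx; [right|left]; exact: g0.
Qed.

End estimate.

(** * Limits of midpoint hulls *)

Section midpoint_hulls.
Context (R : realType) (s : scalar_kind) (K : topologicalType).
Context (cK : compact [set: K]).
Local Notation F := (scalar_field R s).
Local Notation CK := (C_space R s cK).
Implicit Types (f g h : CK).

Section domination.
Context (X : normedModType F) (T : {linear CK -> X}).
Context (C : R) (C0 : 0 < C) (bT : forall f, rn (T f) <= C * rn f).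

Let rn_mid f g : rn f <= 1 -> rn g <= 1 -> rn (emb 2^-1 *: (f + g)) <= 1.
Proof.
move=> f1 g1; rewrite rnZ ger0_norm ?invr_ge0//.
by have := rnD f g; lra.
Qed.

(** A weighted sum of the quadratic functionals for e = 1, 1/2, 1/3, ... *)
Lemma quadratic_domination : uniformly_disjointly_small T ->
  exists2 Q : CK -> R, quadratic Q & forall e, 0 < e ->
    exists2 N, 0 <= N & forall f, rn f <= 1 -> rn (T f) <= N * Q f + e.
Proof.
move=> uds.
have /choice[q qP] n : exists Q, quadratic Q /\ exists N, forall f,
    rn f <= 1 -> rn (T f) <= N * Q f + n.+1%:R^-1.
  have n0 : 0 < n.+1%:R^-1 :> R by rewrite invr_gt0.
  have [Q [N [qQ QN]]] := quadratic_estimate C0 bT uds n0.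
  by exists Q; split=> //; exists N.
pose P n f := \sum_(0 <= i < n) 2^-1 ^+ i.+1 * q i f.
have h0 n : 0 < 2^-1 ^+ n :> R by rewrite exprn_gt0// invr_gt0.
have q0 i f : rn f <= 1 -> 0 <= q i f by have [[H _ _] _] := qP i; exact: H.
have P_le m n f : rn f <= 1 -> (m <= n)%N -> P m f <= P n f.
  move=> f1; elim: n => [|n IH]; first by rewrite leqn0 => /eqP ->.
  rewrite leq_eqVlt => /predU1P[->//|/IH le_mn]; apply: le_trans le_mn _.
  by rewrite [leRHS]/P big_nat_recr//= lerDl mulr_ge0 ?q0// ltW.
have P1 n f : rn f <= 1 -> P n f <= 1 - 2^-1 ^+ n.
  move=> f1; elim: n => [|n IH]; first by rewrite /P big_nil expr0 subrr.
  rewrite /P big_nat_recr//= -/(P n f).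
  have : 2^-1 ^+ n.+1 * q n f <= 2^-1 ^+ n.+1.
    by rewrite ler_piMr ?(ltW (h0 _))//; have [[_ H _] _] := qP n; exact: H.
  by move: IH; rewrite exprSr; lra.
pose Q f := sup (range (P ^~ f)).
have P_Q n f : rn f <= 1 -> P n f <= Q f.
  move=> f1; apply: ub_le_sup; last by exists n.
  exists 1 => _ [m _ <-]; apply: le_trans (P1 m f f1) _.
  by rewrite gerBl ltW.
have Q_le b f : (forall n, P n f <= b) -> Q f <= b.
  by move=> Pb; apply: ge_sup => [|_ [n _ <-]//]; exists (P 0%N f), 0%N.
exists Q.
  split=> [f f1|f f1|f g f1 g1].
  - by apply: le_trans (P_Q 0%N f f1); rewrite /P big_nil.
  - by apply: Q_le => n; apply: le_trans (P1 n f f1) _; rewrite gerBl ltW.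
  - have fg1 : rn (emb 2^-1 *: (f - g)) <= 1.
      by apply: rn_mid => //; rewrite rnN.
    have fg1' : rn (emb 2^-1 *: (f + g)) <= 1 by exact: rn_mid.
    rewrite -lerBrDr; apply: (Q_le) => m; rewrite lerBrDr addrC -lerBrDr.
    apply: (Q_le) => n; rewrite lerBrDr; pose k := maxn m n.
    have Hm := P_le _ k _ fg1 (leq_maxl m n).
    have Hn := P_le _ k _ fg1' (leq_maxr m n).
    have Pfg : P k (emb 2^-1 *: (f - g)) + P k (emb 2^-1 *: (f + g)) <=
        (P k f + P k g) / 2.
      rewrite /P -!big_split /= mulr_suml; apply: ler_sum => i _.
      rewrite -!mulrDr -mulrA ler_pM2l//.
      by have [[_ _ H] _] := qP i; exact: H.
    by have := P_Q k f f1; have := P_Q k g g1; lra.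
move=> e e0; pose n := Num.bound e^-1.
have ne : n.+1%:R^-1 <= e.
  rewrite -[leRHS]invrK lef_pV2 ?posrE ?invr_gt0//.
  apply: le_trans (ltW (archi_boundP _)) _; first by rewrite invr_ge0 ltW.
  by rewrite ler_nat.
have [[q0n _ _] [N NP]] := qP n.
exists (`|N| / 2^-1 ^+ n.+1) => [|f f1]; first by rewrite divr_ge0// ltW.
apply: le_trans (NP f f1) _; apply: lerD => //.
apply: (@le_trans _ _ (`|N| * q n f)).
  by rewrite ler_wpM2r ?ler_norm ?q0.
rewrite -mulrA ler_wpM2l// ler_pdivlMl//; apply: le_trans (P_Q n.+1 f f1).
rewrite /P big_nat_recr//= lerDr sumr_ge0// => i _.
by rewrite mulr_ge0 ?q0// ltW.
Qed.

End domination.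

(** Midpoints are the only convex combinations that the parallelogram law
    involves. *)
Inductive midhull (A : set CK) : CK -> Prop :=
| midhull_in f : A f -> midhull A f
| midhull_mid f g : midhull A f -> midhull A g ->
    midhull A (emb 2^-1 *: (f + g)).

Lemma midhullS A B : A `<=` B -> midhull A `<=` midhull B.
Proof.
move=> AB f; elim=> {f} [f /AB|f g _ fB _ gB]; first exact: midhull_in.
exact: midhull_mid.
Qed.

Let ball1 : set CK := [set f | rn f <= 1].

Lemma midhull_ball A f : A `<=` ball1 -> midhull A f -> rn f <= 1.
Proof.
move=> A1; elim=> {f} [f /A1//|f g _ fB _ gB].
rewrite rnZ ger0_norm ?invr_ge0//.
by have := rnD f g; lra.
Qed.

Context (X : completeNormedModType F) (T : {linear CK -> X}).
Context (C : R) (C0 : 0 < C) (bT : forall f, rn (T f) <= C * rn f).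

(** Let D be the supremum, over the members A of the filter, of the infimum of Q
    on the hull of A. The functions in the hull of A on which Q is less than
    D + eta form, for varying A and eta, a filter base. If the infimum for A is
    greater than D - eta, two of these functions f and g have a midpoint where
    Q exceeds D - eta, so Q is less than 2 eta at (f - g) / 2. As Q dominates T,
    the images form a Cauchy filter. *)
Lemma midhull_limit (U : set_system CK) : ProperFilter U -> U ball1 ->
  uniformly_disjointly_small T ->
  exists x, forall A, U A -> forall e, 0 < e ->
    exists2 f, midhull A f & rn (x - T f) < e.
Proof.
move=> UF U1 uds.
have [Q [Q0 Q1 Qmid] QT] := quadratic_domination C0 bT uds.
pose r A := inf [set Q f | f in midhull (A `&` ball1)].
have mb A f : midhull (A `&` ball1) f -> rn f <= 1.
  by apply: midhull_ball => g [].
have r_le A f : midhull (A `&` ball1) f -> r A <= Q f.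
  move=> Af; apply: ge_inf; last by exists f.
  by exists 0 => _ [g /mb/Q0 ? <-].
have hull0 A : U A -> exists f, midhull (A `&` ball1) f.
  move=> UA; have [f Af] := filter_ex (filterI UA U1).
  by exists f; exact: midhull_in.
pose D := sup [set r A | A in U].
have r_D A : U A -> r A <= D.
  move=> UA; apply: ub_le_sup; last by exists A.
  exists 1 => _ [B UB <-]; have [f Bf] := hull0 B UB.
  exact: le_trans (r_le _ _ Bf) (Q1 f (mb _ _ Bf)).
pose S (p : set CK * R) : set X :=
  [set T f | f in [set f | midhull (p.1 `&` ball1) f /\ Q f < D + p.2]].
pose I : set (set CK * R) := [set p | U p.1 /\ 0 < p.2].
have Sex p : I p -> S p !=set0.
  case: p => A eta [/= UA eta0].
  have hasr : has_inf [set Q f | f in midhull (A `&` ball1)].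
    split; first by have [f Af] := hull0 A UA; exists (Q f), f.
    by exists 0 => _ [g /mb/Q0 ? <-].
  have [_ [f Af <-] fD] := inf_adherent eta0 hasr.
  exists (T f), f => //; split=> //.
  by apply: lt_le_trans fD _; rewrite lerD2r; exact: r_D.
have GF : Filter (filter_from I S).
  apply: filter_from_filter.
    by exists (setT, 1); split=> //; exact: filterT.
  move=> [A a] [B b] [/= UA a0] [/= UB b0].
  exists (A `&` B, Num.min a b).
    by split=> /=; [exact: filterI|rewrite lt_min a0 b0].
  move=> _ [f [/= Af fD] <-]; split; exists f => //; split=> /=.
  - by apply: midhullS Af => g [[]].
  - by apply: lt_le_trans fD _; rewrite lerD2l ge_min lexx.
  - by apply: midhullS Af => g [[]].
  - by apply: lt_le_trans fD _; rewrite lerD2l ge_min lexx orbT.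
have GPF : ProperFilter (filter_from I S) by exact: filter_from_proper.
have close e : 0 < e -> exists2 p, I p & forall f g,
    midhull (p.1 `&` ball1) f -> Q f < D + p.2 ->
    midhull (p.1 `&` ball1) g -> Q g < D + p.2 -> rn (T f - T g) < e.
  move=> e0; have e80 : 0 < e / 8 by lra.
  have [N N0 NT] := QT _ e80.
  pose eta := e / 8 / (N + 1); have N10 : 0 < N + 1 by lra.
  have eta0 : 0 < eta by rewrite divr_gt0.
  have Neta : N * eta <= e / 8.
    rewrite /eta mulrCA ler_piMr ?(ltW e80)// ler_pdivrMr//; lra.
  have hasD : has_sup [set r A | A in U].
    split; first by exists (r setT), setT => //; exact: filterT.
    exists 1 => _ [B UB <-]; have [f Bf] := hull0 B UB.
    exact: le_trans (r_le _ _ Bf) (Q1 f (mb _ _ Bf)).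
  have [_ [A UA <-] Ar] := sup_adherent eta0 hasD.
  exists (A, eta) => // f g /= Af fD Ag gD.
  have f1 := mb _ _ Af; have g1 := mb _ _ Ag.
  have mid := r_le _ _ (midhull_mid Af Ag).
  have par := Qmid f g f1 g1.
  have fg1 : rn (emb 2^-1 *: (f - g)) <= 1.
    rewrite rnZ ger0_norm ?invr_ge0//.
    by have := rnD f (- g); rewrite rnN; lra.
  have := NT _ fg1; rewrite linearZ_LR rnZ ger0_norm ?invr_ge0// linearB.
  have Qs : Q (emb 2^-1 *: (f - g)) <= 2 * eta by rewrite -/D in Ar; lra.
  have : N * Q (emb 2^-1 *: (f - g)) <= N * (2 * eta) by rewrite ler_wpM2l.
  by lra.
have [x Gx] : exists x : X, filter_from I S --> x.
  suff /cauchy_cvg/cvg_ex : cauchy (filter_from I S) by [].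
  apply: cauchy_exP => eps eps0.
  have e0 : 0 < rpart eps by rewrite -(ltr_emb s) rmorph0 rpartK// ltW.
  have [p Ip pclose] := close _ e0.
  have [_ [f [pf fD] _]] := Sex p Ip.
  exists (T f); exists p => // _ [g [pg gD] <-].
  rewrite -ball_normE /= -rnE -[eps]rpartK ?ltW// ltr_emb.
  exact: pclose.
exists x => A UA e e0.
have SA : filter_from I S (S (A, 1)) by exists (A, 1).
have xe : filter_from I S [set y | rn (x - y) < e].
  by apply: Gx; apply/nbhs_rnP; exists e.
have [y [[f [/= Af _] <-] fx]] := filter_ex (filterI SA xe).
by exists f => //; apply: midhullS Af => g [].
Qed.

End midpoint_hulls.

(** * Weak compactness *)

Section weak_compactness.
Context (R : realType) (s : scalar_kind) (K : topologicalType).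
Context (cK : compact [set: K]).
Local Notation F := (scalar_field R s).
Local Notation CK := (C_space R s cK).
Context (X : completeNormedModType F) (T : {linear CK -> X}).
Context (C : R) (C0 : 0 < C) (bT : forall f, rn (T f) <= C * rn f).

Let TB : set X := T @` [set v | `|v| <= 1].

(** The complement of a disc is covered by finitely many half-planes, so an
    ultrafilter that contains no preimage of these contains that of the disc. *)
Lemma ultra_half_spaces (G : set_system X) (phi : X -> F) (x : X) (e : R) :
  UltraFilter G ->
  (forall c, c \in turns R s ->
    ~ G [set y | e / 2 <= rpart (c * (phi x - phi y))]) ->
  \forall y \near G, rn (phi x - phi y) < e.
Proof.
move=> UG H.
have {}H c : c \in turns R s -> G [set y | rpart (c * (phi x - phi y)) < e / 2].
  move=> /H nG; have [//|Gn] := in_ultra_setVsetC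
    [set y | rpart (c * (phi x - phi y)) < e / 2] UG.
  by case: nG; apply: filterS Gn => y /= /negP; rewrite -leNgt.
have : G [set y | forall c, c \in turns R s ->
    rpart (c * (phi x - phi y)) < e / 2].
  elim: (turns R s) H => [_|c l IH H]; first by apply: filterE.
  have Gl : G [set y | forall c, c \in l ->
      rpart (c * (phi x - phi y)) < e / 2].
    by apply: IH => c' c'l; apply: H; rewrite inE c'l orbT.
  apply: filterS2 (H c (mem_head _ _)) Gl => y cy ly c'.
  by rewrite inE => /predU1P[->//|]; exact: ly.
by apply: filterS => y; exact: rn_lt_turns.
Qed.

(** If G contained a half-space that is at a positive distance from x, then all
    midpoint hulls of its preimage would be mapped into it, but some of their
    members are mapped close to x. *)
Let ultra_image_ball_cvg (G : set_system X) :
  uniformly_disjointly_small T -> UltraFilter G -> G TB ->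
  exists x, G --> (x : weak_topology X).
Proof.
move=> uds UG GTB.
pose B1 : set CK := [set f | rn f <= 1].
pose U := filter_from G (fun A => T @^-1` A `&` B1).
have UF : Filter U.
  apply: filter_from_filter; first by exists TB.
  move=> A B GA GB; exists (A `&` B); first exact: filterI.
  by move=> f [[? ?] ?].
have UPF : ProperFilter U.
  apply: filter_from_proper => A GA.
  have [_ [[f /= f1 <-] Af]] := filter_ex (filterI GTB GA).
  exists f; split=> //.
  by rewrite /B1 /= -(ler_emb s) rnE rmorph1.
have UB1 : U B1 by exists TB => // f [].
have [x xP] := midhull_limit C0 bT UPF UB1 uds.
exists x; apply/weak_cvgP => phi cphi.
apply: (proj2 (@cvg_rnP R s X _ _ F _ _)) => e e0.
apply: ultra_half_spaces => c ct GB.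
have e20 : 0 < e / 2 by lra.
have [del del0 dphi] := proj1 (nbhs_rnP x _)
  (proj1 (@cvg_rnP R s X _ _ F _ _) (cphi x) _ e20).
have UA : U (T @^-1` [set y | e / 2 <= rpart (c * (phi x - phi y))] `&` B1).
  by exists [set y | e / 2 <= rpart (c * (phi x - phi y))].
have [f fA fx] := xP _ UA _ del0.
have : e / 2 <= rpart (c * (phi x - phi (T f))).
  elim: fA => {f fx} [f [] //|f g _ Hf _ Hg].
  have -> : phi x - phi (T (emb 2^-1 *: (f + g))) =
      emb 2^-1 * (phi x - phi (T f) + (phi x - phi (T g))).
    have h2 : emb 2^-1 * (phi x + phi x) = phi x.
      have -> : phi x + phi x = emb 2%:R * phi x.
        by rewrite rmorph_nat mulr_natl mulr2n.
      by rewrite mulrA -rmorphM mulVf ?pnatr_eq0// rmorph1 mul1r.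
    rewrite linearZ_LR linearD linearZ_LR linearD addrACA -opprD mulrBr.
    by rewrite h2.
  by rewrite mulrCA rpart_embM mulrDr raddfD /=; lra.
apply/negP; rewrite -ltNge; apply: le_lt_trans (rpart_le_rn _) _.
by rewrite rnM (rn_turns ct) mul1r; exact: dphi.
Qed.

Let weak_far_open (phi : {linear X -> F^o}) (x : X) (e : R) : continuous phi ->
  open ([set y | e < rn (phi x - phi y)] : set (weak_topology X)).
Proof.
move=> cphi.
have wphi : continuous (phi : weak_topology X -> F).
  move=> y.
  pose near_y := nbhs (y : weak_topology X).
  exact: (proj1 (@weak_cvgP R s X near_y y _) cvg_id phi cphi).
have cd : continuous (fun z : F => rn (phi x - z) : R).
  move=> z.
  apply: (@continuous_comp _ _ _ (fun z : F => phi x - z) (@rn R s F)).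
    by apply: (@cvgB _ _ _ (nbhs z)); [exact: cvg_cst|exact: cvg_id].
  exact: rn_continuous.
have oe : open [set z : F | e < rn (phi x - z)].
  exact: (proj1 (continuousP _) cd _ (@open_gt _ e)).
exact: (proj1 (continuousP _) wphi _ oe).
Qed.

(** An ultrafilter G on the weak closure of the image of the ball need not
    contain the image itself. But the open members of G meet the image, and an
    ultrafilter that contains these intersections converges to some x. If G did
    not, the points that some functional separates from x would form an open
    member of G. *)
Lemma uniformly_disjointly_small_weakly_compact :
  uniformly_disjointly_small T -> weakly_compact T.
Proof.
move=> uds; rewrite /weakly_compact precompactE compact_ultra => G UG GTB.
pose W := weak_topology X.
pose H := filter_from [set A : set W | open A /\ G A] (fun A => A `&` TB).
have HF : Filter H.
  apply: filter_from_filter.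
    by exists setT; split; [exact: openT|exact: filterT].
  move=> A B [oA GA] [oB GB]; exists (A `&` B).
    by split; [exact: openI|exact: filterI].
  by move=> y [[]].
have HPF : ProperFilter H.
  apply: filter_from_proper => A [oA GA].
  have [y [Ay yTB]] := filter_ex (filterI GA GTB).
  have [z [zTB Az]] := yTB A (open_nbhs_nbhs (conj oA Ay)).
  by exists z.
have [H' [UH' HH']] := ultraFilterLemma HPF.
have H'TB : H' TB.
  apply: HH'; exists setT; last by move=> y [].
  by split; [exact: openT|exact: filterT].
have [x H'x] := ultra_image_ball_cvg uds UH' H'TB.
exists x; split.
  by move=> B /H'x H'B; exact: filter_ex (filterI H'TB H'B).
apply/weak_cvgP => phi cphi.
apply: (proj2 (@cvg_rnP R s X _ _ F _ _)) => e e0.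
have [//|Gfar] := in_ultra_setVsetC [set y | rn (phi x - phi y) < e] UG.
have e20 : 0 < e / 2 by lra.
have Gfar2 : G [set y | e / 2 < rn (phi x - phi y)].
  by apply: filterS Gfar => y /= /negP; rewrite -leNgt; lra.
have H'far : H' [set y | e / 2 < rn (phi x - phi y)].
  apply: HH'; exists [set y | e / 2 < rn (phi x - phi y)]; last by move=> y [].
  by split=> //; exact: weak_far_open.
have H'near : H' [set y | rn (phi x - phi y) < e / 2].
  apply: (proj1 (@cvg_rnP R s X H' _ F phi (phi x))) => //.
  exact: (proj1 (weak_cvgP x _) H'x phi cphi).
have [y [/= far near]] := filter_ex (filterI H'far H'near).
by move: (lt_trans far near); rewrite ltxx.
Qed.

End weak_compactness.

Theorem proposition2p1 (R : realType) (s : scalar_kind)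
    (K : topologicalType) (cK : compact [set: K]) (hK : hausdorff_space K)
    (X : completeNormedModType (scalar_field R s))
    (T : {linear C_space R s cK -> X}) (bT : bounded_operator T) :
  (weakly_compact T <-> infinite_chain_condition T) /\
  (weakly_compact T -> condition_B T).
Proof.
have [C C0 TC] : exists2 C : R, 0 < C & forall f, rn (T f) <= C * rn f.
  have [M TM] := bT; exists (rn M + 1) => [|f].
    by rewrite ltr_wpDl// rn_ge0.
  rewrite -(ler_emb s) rnE; apply: le_trans (TM f) _.
  have MM : 0 <= M * `|f| by exact: le_trans (TM f).
  rewrite -(ger0_norm MM) normrM normr_id -(rnE M) -(rnE f) -rmorphM ler_emb.
  by rewrite ler_wpM2r ?rn_ge0// lerDl.
have small_of P :
    (forall e d psi, 0 < e -> almost_biorthogonal T e d psi -> ~ P) ->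
    P -> uniformly_disjointly_small T.
  move=> nP p; apply: (disjointly_small_uniform C0 TC); apply: contrapT.
  move=> /(not_disjointly_small C0 TC)[e [d [psi [e0 dpsi]]]].
  exact: nP e0 dpsi p.
have wc_chain : weakly_compact T -> infinite_chain_condition T.
  move=> wc; apply: uniformly_disjointly_small_chain.
  apply: (small_of _ _ wc) => e d psi e0 dpsi.
  exact: almost_biorthogonal_weakly_compact e0 dpsi.
split; first split=> // ch.
  apply: (uniformly_disjointly_small_weakly_compact C0 TC).
  apply: (small_of _ _ ch) => e d psi e0 dpsi.
  exact: almost_biorthogonal_chain e0 dpsi.
move=> /wc_chain ch A uncA Ach Abnd; apply: ch => //.
by move=> finA; apply: uncA; exact: finite_set_countable.
Qed.
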